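(* Let $G=(V,E)$ be a graph on $n$ vertices that is not isomorphic to any of $W_5$, $B_6$, $C_7^1$, $C_7^2$. If $\deg(u)+\deg(v)\geq n+1$ for all pairs of distinct non-adjacent vertices $u,v$ of $G$, then $G$ is rigid in $\mathbb{R}^3$.
   Context: All graphs are finite and simple. A graph is rigid in $\mathbb{R}^d$ if some (equivalently every) generic $d$-dimensional bar-and-joint framework of it (vertex positions with coordinates algebraically independent over $\mathbb{Q}$) is rigid, i.e. admits no continuous edge-length-preserving motion changing some pairwise distance. $W_5$ is the wheel on five vertices (a cone over a 4-cycle). $B_6$ is obtained from $K_6$ by deleting the edges of two vertex-disjoint paths on three vertices each. $C_7^1$ is obtained from $K_7$ by deleting the edges of two vertex-disjoint cycles, one of length three and one of length four. $C_7^2$ is obtained from $K_7$ by deleting the edges of a Hamiltonian cycle (a cycle on all seven vertices). *)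

(* Defs.v *)
From HB Require Import structures.
From mathcomp Require Import all_boot all_order all_algebra.
(* mpoly must be Imported before MathComp-Analysis to avoid a notation clash *)
From mathcomp Require Import mpoly.
From mathcomp Require Import all_classical all_reals all_analysis.
Set Implicit Arguments. Unset Strict Implicit. Unset Printing Implicit Defensive.
Import Order.TTheory GRing.Theory Num.Theory.
Import numFieldNormedType.Exports.
Local Open Scope ring_scope.
Local Open Scope classical_set_scope.

Definition simple_graph (T : finType) (e : rel T) : Prop :=
  ssrbool.symmetric e /\ ssrbool.irreflexive e.

Definition deg (T : finType) (e : rel T) (x : T) : nat := #|[set y | e x y]|.

Definition graph_iso (T T' : finType) (e : rel T) (e' : rel T') : Prop :=
  exists f : T -> T', bijective f /\ forall x y, e' (f x) (f y) = e x y.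

Definition del_graph (k : nat) (del : seq (nat * nat)) : rel 'I_k :=
  fun x y => (x != y) &&
    ~~ has (fun p : nat * nat => ((p.1 == val x) && (p.2 == val y)) || ((p.1 == val y) && (p.2 == val x))) del.

(* W_5: cone (apex 4) over the 4-cycle 0-1-2-3-0; = K_5 minus the two
   diagonals {0,2},{1,3} of the 4-cycle. *)
Definition W5 : rel 'I_5 := @del_graph 5 [:: (0,2); (1,3)]%N.
Definition B6 : rel 'I_6 := @del_graph 6 [:: (0,1); (1,2); (3,4); (4,5)]%N.
Definition C71 : rel 'I_7 :=
  @del_graph 7 [:: (0,1); (1,2); (2,0); (3,4); (4,5); (5,6); (6,3)]%N.
Definition C72 : rel 'I_7 :=
  @del_graph 7 [:: (0,1); (1,2); (2,3); (3,4); (4,5); (5,6); (6,0)]%N.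

Definition alg_indep (R : realType) (I : finType) (x : I -> R) : Prop :=
  forall (m : nat) (g : 'I_m -> I), injective g ->
  forall p : {mpoly rat[m]}, p != 0%R ->
    mmap (fun q : rat => ratr q : R) (fun k => x (g k)) p != 0%R.

Definition sqdist (R : realType) (d : nat) (a b : 'I_d -> R) : R :=
  \sum_(i < d) (a i - b i) ^+ 2.

Definition generic (R : realType) (T : finType) (d : nat) (p : T -> 'I_d -> R) : Prop :=
  alg_indep (fun xi : T * 'I_d => p xi.1 xi.2).

Definition unit_interval (R : realType) : set R := `[(0:R), (1:R)].

Definition nontrivial_motion (R : realType) (T : finType) (d : nat) (e : rel T)
    (p : T -> 'I_d -> R) (P : R -> T -> 'I_d -> R) : Prop :=
  [/\ forall x i, {within @unit_interval R, continuous (fun t : R => P t x i)},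
      P 0 = p,
      forall t, @unit_interval R t -> forall x y, e x y ->
        sqdist (P t x) (P t y) = sqdist (p x) (p y)
    & exists t, exists x, exists y, @unit_interval R t /\
        sqdist (P t x) (P t y) != sqdist (p x) (p y)].

Definition framework_rigid (R : realType) (T : finType) (d : nat) (e : rel T)
    (p : T -> 'I_d -> R) : Prop :=
  forall P : R -> T -> 'I_d -> R, ~ nontrivial_motion e p P.

(* Generic rigidity in R^d: every generic framework is rigid (the paper's
   "some (equivalently every)"; we use "every"). *)
Definition rigid_in (R : realType) (d : nat) (T : finType) (e : rel T) : Prop :=
  forall p : T -> 'I_d -> R, generic p -> framework_rigid e p.

(* Main.v *)
(* Let p be generic, let g be the graph of all pairs whose rigidity row at p lies
   in the span of the rows of e, and suppose that g is not complete, so that the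
   rank of the rigidity matrix is at most 3n - 7.  Adding the vertices in random
   order, a vertex preceded by a set S of g-neighbours raises the rank by
   min(3, |S|), and by 4 if |S| >= 4 and S is not a clique of g (1-extension).  By
   the degree condition no neighbourhood is a clique, and in g two cliques meeting
   in three vertices span a clique; hence a vertex of degree d contributes at
   least 7/2 - 6/d on average.  So the sum of 12/d(v) is at least n + 14, which the
   degree condition allows only for n <= 7, and then only for the four exceptional
   graphs.  That an infinitesimally rigid generic p is rigid follows from the
   identity |P|^2 - |Q|^2 = 2 <(P + Q)/2, P - Q>: it turns P - Q into an
   infinitesimal motion of the average of two frameworks with equal edge lengths. *)

(* The count has no slack: each of the four exceptional graphs has the sum of 12/d(v) equal to n +
   14. It runs over g rather than over the given graph because a 1-extension on a, b needs the row
   of ab to lie outside the span of the rows already present, and non-adjacency in g guarantees this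
   whatever set of vertices has been added. Degrees can only grow from the given graph to g, so the
   resulting inequality passes back to the given graph, whose isomorphism type is then determined.
   Genericity enters as maximality of the rank: a lower bound for the rank at p may be proved at any
   convenient placement, with vertices at unit vectors or at a midpoint. *)
Require Import Defs.
From HB Require Import structures.
From mathcomp Require Import all_boot all_order all_algebra.
From mathcomp Require Import mpoly.
From mathcomp Require Import all_classical all_reals all_analysis.
From mathcomp Require Import ring lra zify.
Set Implicit Arguments. Unset Strict Implicit. Unset Printing Implicit Defensive.
Import fintype boot.finset zmodp.
Import Order.TTheory GRing.Theory Num.Theory.
Import numFieldNormedType.Exports.
Local Open Scope ring_scope.

(** * Generic rank *)

Section Generic.
Variables (R : realType) (T : finType) (d : nat).
Implicit Types (q : T -> 'I_d -> R).

Definition coord_var (x : T) (i : 'I_d) : {mpoly rat[#|{: T * 'I_d}|]} :=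
  'X_(enum_rank (x, i)).

Definition mpoly_at q : {mpoly rat[#|{: T * 'I_d}|]} -> R :=
  mmap (@ratr R) (fun k => q (enum_val k).1 (enum_val k).2).

HB.instance Definition _ q := GRing.RMorphism.on (mpoly_at q).

Lemma mpoly_at_var q x i : mpoly_at q (coord_var x i) = q x i.
Proof. by rewrite /mpoly_at /coord_var mmapX mmap1U enum_rankK. Qed.

Lemma mxrank_mxsub (F : fieldType) m n m' n' (f : 'I_m' -> 'I_m) (g : 'I_n' -> 'I_n)
  (A : 'M[F]_(m, n)) : (\rank (mxsub f g A) <= \rank A)%N.
Proof.
rewrite -[A in mxsub _ _ A]mulmx1 mxsub_mul.
exact: leq_trans (mxrankM_maxl _ _) (mxrankS (rowsub_sub _ _)).
Qed.

Lemma full_minor (F : fieldType) m n (A : 'M[F]_(m, n)) :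
  exists f : 'I_(\rank A) -> 'I_m, exists g : 'I_(\rank A) -> 'I_n,
    \det (mxsub f g A) != 0.
Proof.
exists (maxrankfun A).
set B := rowsub (maxrankfun A) A.
have fB : row_full B^T by rewrite /row_full mxrank_tr -/(row_free B) /B maxrowsub_free.
exists (fullrankfun fB).
rewrite -unitfE -unitmxE -unitmx_tr.
have -> : (mxsub (maxrankfun A) (fullrankfun fB) A)^T = rowsub (fullrankfun fB) B^T.
  by apply/matrixP => i j; rewrite !mxE.
exact: fullrowsub_unit.
Qed.

(* Some minor of full size is nonzero at q, hence a nonzero polynomial, hence nonzero at p. *)
Lemma generic_rank p q m n (A : 'M[{mpoly rat[#|{: T * 'I_d}|]}]_(m, n)) :
  generic p ->
  (\rank (map_mx (mpoly_at q) A) <= \rank (map_mx (mpoly_at p) A))%N.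
Proof.
move=> gp; have [f [g]] := full_minor (map_mx (mpoly_at q) A).
rewrite -map_mxsub det_map_mx => Dn0.
have := gp _ _ enum_val_inj (\det (mxsub f g A)).
have -> : \det (mxsub f g A) != 0.
  by apply: contra_neq Dn0 => ->; rewrite rmorph0.
move/(_ isT).
rewrite -[mmap _ _ _]/(mpoly_at p (\det (mxsub f g A))) -det_map_mx -unitfE -unitmxE.
move/mxrank_unit => <-; rewrite map_mxsub; exact: mxrank_mxsub.
Qed.

End Generic.

(** * The rigidity matrix and its row space *)

Section RigidityMatrix.
Variables (R : realType) (T : finType) (d : nat).
Implicit Types (p q u : T -> 'I_d -> R) (F : rel T).

Definition rig_row q (x y : T) : 'rV[R]_(#|T| * d) :=
  mxvec (\matrix_(i, k)
    (((enum_val i == x)%:R - (enum_val i == y)%:R) * (q x k - q y k))).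

(** Pairs outside [F] keep a zero row, so the shape does not depend on [F] and different relations
    are compared through row spaces. *)
Definition rig_mx q F : 'M[R]_(#|{: T * T}|, #|T| * d) :=
  \matrix_i (let xy := enum_val i in
             if F xy.1 xy.2 then rig_row q xy.1 xy.2 else 0).

Definition motion_vec u : 'rV[R]_(#|T| * d) :=
  mxvec (\matrix_(i, k) u (enum_val i) k).

(** Half the derivative of the squared length of xy when [q] moves with velocity [u]. *)
Definition strain q u (x y : T) : R :=
  \sum_k (q x k - q y k) * (u x k - u y k).

Lemma rig_rowC q x y : rig_row q x y = rig_row q y x.
Proof. by congr mxvec; apply/matrixP => i k; rewrite !mxE; ring. Qed.

Lemma mxvec_dot m n (A B : 'M[R]_(m, n)) :
  (mxvec A *m (mxvec B)^T) 0 0 = \sum_i \sum_j A i j * B i j.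
Proof.
rewrite mxE (reindex _ (curry_mxvec_bij _ _)) /= pair_bigA /=.
by apply: eq_bigr => -[i j] _; rewrite mxE /= !mxvecE.
Qed.

Lemma rig_row_motion q u x y : rig_row q x y *m (motion_vec u)^T = (strain q u x y)%:M.
Proof.
apply/rowP => j; rewrite ord1 mxvec_dot !mxE eqxx mulr1n.
rewrite exchange_big /=; apply: eq_bigr => k _.
under eq_bigr do rewrite !mxE.
pose G (z : T) : R := ((z == x)%:R - (z == y)%:R) * (q x k - q y k) * u z k.
rewrite (reindex (@enum_rank T)) /=; last by apply: onW_bij; exact: enum_rank_bij.
under eq_bigr do rewrite enum_rankK.
have sumE w : \sum_z ((z == w)%:R : R) * u z k = u w k.
  by rewrite (bigD1 w) //= eqxx mul1r big1 ?addr0 // => z /negPf ->; rewrite mul0r.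
transitivity (\sum_z ((q x k - q y k) * ((z == x)%:R * u z k)
    - (q x k - q y k) * ((z == y)%:R * u z k))).
  by apply: eq_bigr => z _; ring.
by rewrite sumrB -!mulr_sumr !sumE; ring.
Qed.

Lemma rig_row_sub q F x y : F x y -> (rig_row q x y <= rig_mx q F)%MS.
Proof.
move=> Fxy; have := row_sub (enum_rank (x, y)) (rig_mx q F).
by rewrite rowK enum_rankK /= Fxy.
Qed.

Lemma rig_mx_subP q F m (B : 'M[R]_(m, #|T| * d)) :
  (forall x y, F x y -> (rig_row q x y <= B)%MS) -> (rig_mx q F <= B)%MS.
Proof.
move=> FB; apply/row_subP => i; rewrite rowK /=.
by case: ifP => [/FB // | _]; exact: sub0mx.
Qed.

Lemma rig_mx_sub q F F' : subrel F F' -> (rig_mx q F <= rig_mx q F')%MS.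
Proof. by move=> FF'; apply: rig_mx_subP => x y /FF' /rig_row_sub. Qed.

(** Duality: a row lies in a row space exactly when every vector orthogonal to that space is
    orthogonal to it, and the orthogonal vectors are the infinitesimal motions. *)
Lemma rig_row_subP q F x y :
  reflect (forall u, (forall a b, F a b -> strain q u a b = 0) -> strain q u x y = 0)
          (rig_row q x y <= rig_mx q F)%MS.
Proof.
apply: (iffP idP) => [/submxP[D rE] u Fu | H].
  have := rig_row_motion q u x y; rewrite rE -mulmxA.
  have -> : rig_mx q F *m (motion_vec u)^T = 0.
    apply/row_matrixP => i; rewrite row_mul rowK row0 /=.
    by case: ifP => [/Fu Fe | _]; rewrite ?mul0mx // rig_row_motion Fe raddf0.
  by rewrite mulmx0 => /rowP /(_ 0); rewrite !mxE eqxx mulr1n.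
rewrite submxE; apply/eqP/matrixP => i j.
(* Each column of the cokernel is read as a velocity field [u]; it has zero strain on [F], so by
   hypothesis on xy too. *)
pose w := (col j (cokermx (rig_mx q F)))^T.
pose u x k := vec_mx w (enum_rank x) k.
have uE : motion_vec u = w.
  rewrite -[RHS]vec_mxK; congr mxvec; apply/matrixP => a k.
  by rewrite mxE /u enum_valK.
have rw a b : rig_row q a b *m w^T = (strain q u a b)%:M by rewrite -uE rig_row_motion.
have := rw x y; rewrite H => [| a b /(rig_row_sub q) Fab].
  rewrite trmxK colE mulmxA -colE => /colP /(_ i).
  by rewrite !mxE mul0rn.
have := rw a b; rewrite trmxK colE mulmxA.
move: Fab; rewrite submxE => /eqP ->; rewrite mul0mx => /rowP /(_ 0).
by rewrite !mxE eqxx mulr1n.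
Qed.

(** The entries are rational polynomials in the coordinates, so [generic_rank] applies. This is what
    allows special placements in rank lower bounds. *)
Lemma generic_rig_rank p q F :
  generic p -> (\rank (rig_mx q F) <= \rank (rig_mx p F))%N.
Proof.
move=> gp.
pose A : 'M[{mpoly rat[#|{: T * 'I_d}|]}]_(#|{: T * T}|, #|T| * d) :=
  \matrix_i (let xy := enum_val i in if F xy.1 xy.2 then
    mxvec (\matrix_(i, k) (((enum_val i == xy.1)%:R - (enum_val i == xy.2)%:R) *
       (coord_var xy.1 k - coord_var xy.2 k))) else 0).
have AE r : rig_mx r F = map_mx (mpoly_at r) A.
  apply/row_matrixP => i; rewrite -map_row !rowK /=; case: ifP => _; last by rewrite map_mx0.
  rewrite map_mxvec; congr mxvec; apply/matrixP => a k.
  by rewrite !mxE rmorphM !rmorphB !rmorph_nat /= !mpoly_at_var.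
by rewrite !AE; exact: generic_rank.
Qed.

End RigidityMatrix.

(** * Extensions and cliques *)

Section Extensions.
Variables (R : realType) (T : finType) (d : nat).
Implicit Types (p q u : T -> 'I_d -> R) (F : rel T).

Definition diff_mx q v k (s : 'I_k -> T) : 'M[R]_(k, d) :=
  \matrix_(i, j) (q v j - q (s i) j).

Lemma generic_diff_free p v k (s : 'I_k -> T) :
  generic p -> injective s -> (forall i, s i != v) -> (k <= d)%N ->
  row_free (diff_mx p v s).
Proof.
move=> gp sI sv kd.
pose A : 'M[{mpoly rat[#|{: T * 'I_d}|]}]_(k, d) :=
  \matrix_(i, j) (coord_var v j - coord_var (s i) j).
have AE r : diff_mx r v s = map_mx (mpoly_at r) A.
  by apply/matrixP => i j; rewrite !mxE rmorphB /= !mpoly_at_var.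
(* Special placement: [v] at the origin and [s i] at minus the i-th unit vector. *)
pose q x (j : 'I_d) : R := - \sum_(i < k) ((s i == x) && (val i == val j))%:R.
have qE : diff_mx q v s = pid_mx k.
  apply/matrixP => i j; rewrite !mxE /q big1 => [|i' _]; last by rewrite (negPf (sv i')).
  rewrite oppr0 sub0r opprK (bigD1 i) //= eqxx /= big1 => [|i' i'i].
    by rewrite addr0 ltn_ord andbT.
  by rewrite (inj_eq sI) (negPf i'i).
have := generic_rank q A gp; rewrite -!AE qE rank_pid_mx // => kr.
by rewrite /row_free eqn_leq rank_leq_row kr.
Qed.

(** Right multiplication by it extracts the [d] columns that belong to [v]. *)
Definition proj_vertex (v : T) : 'M[R]_(#|T| * d, d) :=
  lin1_mx (row (enum_rank v) \o vec_mx).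

Lemma rig_row_proj q v x y j :
  (rig_row q x y *m proj_vertex v) 0 j = ((v == x)%:R - (v == y)%:R) * (q x j - q y j).
Proof. by rewrite mul_rV_lin1 /= mxvecK !mxE enum_rankK. Qed.

Lemma rig_mx_proj0 q F v :
  (forall x y, F x y -> (x != v) && (y != v)) -> rig_mx q F *m proj_vertex v = 0.
Proof.
move=> Fv; apply/row_matrixP => i; rewrite row_mul rowK row0 /=.
case: ifP => [/Fv /andP[xv yv] | _]; last by rewrite mul0mx.
by apply/rowP => j; rewrite rig_row_proj ![v == _]eq_sym (negPf xv) (negPf yv) subrr mul0r mxE.
Qed.

(** Rank-nullity for the projection of [C] to the columns of [v]: the star rows give an image of
    rank at least [k], and [A] lies in the kernel. *)
Lemma rank_add_star q v k (s : 'I_k -> T) m n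
    (A : 'M[R]_(m, #|T| * d)) (C : 'M[R]_(n, #|T| * d)) :
  A *m proj_vertex v = 0 -> (forall i, s i != v) -> row_free (diff_mx q v s) ->
  (A <= C)%MS -> (forall i, (rig_row q v (s i) <= C)%MS) ->
  (\rank A + k <= \rank C)%N.
Proof.
move=> Av sv sfree AC sC; rewrite -(mxrank_mul_ker C (proj_vertex v)) addnC leq_add //.
  have <- : \rank (diff_mx q v s) = k by exact/eqP.
  apply/mxrankS/row_subP => i.
  have -> : row i (diff_mx q v s) = rig_row q v (s i) *m proj_vertex v.
    apply/rowP => j; rewrite rig_row_proj !mxE eqxx [v == _]eq_sym (negPf (sv i)).
    by rewrite subr0 mul1r.
  exact: submxMr.
by apply: mxrankS; rewrite sub_capmx AC; apply/sub_kermxP.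
Qed.

Definition induced_rel (g : rel T) (W : {set T}) : rel T :=
  fun x y => [&& x \in W, y \in W & g x y].

Lemma induced_proj0 q g (W : {set T}) v : v \notin W -> rig_mx q (induced_rel g W) *m proj_vertex v = 0.
Proof.
move=> vW; apply: rig_mx_proj0 => x y /and3P[xW yW _].
by apply/andP; split; apply: contraNneq vW => <-.
Qed.

Lemma induced_sub g (W W' : {set T}) : W \subset W' -> subrel (induced_rel g W) (induced_rel g W').
Proof. by move=> /subsetP s x y /and3P[/s xW /s yW gxy]; rewrite /induced_rel xW yW. Qed.

Lemma zero_extension p (g : rel T) (W : {set T}) v (S : {set T}) :
  generic p -> v \notin W -> S \subset W -> (forall x, x \in S -> g v x) ->
  (\rank (rig_mx p (induced_rel g W)) + minn d #|S| <=
   \rank (rig_mx p (induced_rel g (v |: W))))%N.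
Proof.
move=> gp vW SW gS.
pose s (i : 'I_(minn d #|S|)) : T := enum_val (widen_ord (geq_minr d #|S|) i).
have sS i : s i \in S by exact: enum_valP.
have sv i : s i != v by apply: contraNneq vW => <-; exact: (subsetP SW).
apply: (rank_add_star (q := p) (s := s) (v := v)) => //.
- exact: induced_proj0.
- apply: generic_diff_free => //; last exact: geq_minl.
  by move=> i j /enum_val_inj /(congr1 val) /= ij; apply: val_inj.
- by apply/rig_mx_sub/induced_sub/subsetUr.
- move=> i; apply: rig_row_sub.
  by rewrite /induced_rel !inE eqxx (gS _ (sS i)) (subsetP SW _ (sS i)) orbT.
Qed.

Lemma eq_rig_row q q' x y : q x =1 q' x -> q y =1 q' y -> rig_row q x y = rig_row q' x y.
Proof.
by move=> ex ey; congr mxvec; apply/matrixP => i k; rewrite !mxE ex ey.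
Qed.

(* The new vertex is placed at the midpoint of a and b: there the rows va and
   vb add up to half the row ab. *)
Lemma one_extension p (g : rel T) (W : {set T}) v a b (s : 'I_d -> T) (i0 : 'I_d) :
  generic p -> v \notin W -> injective s -> s i0 = b ->
  (forall i, s i != a) ->
  a \in W -> (forall i, s i \in W) -> g v a -> (forall i, g v (s i)) ->
  ~~ (rig_row p a b <= rig_mx p (induced_rel g W))%MS ->
  (\rank (rig_mx p (induced_rel g W)) + d.+1 <=
   \rank (rig_mx p (induced_rel g (v |: W))))%N.
Proof.
move=> gp vW sI si0 sa aW sW gva gvs abN.
pose q x k : R := if x == v then (p a k + p b k) / 2 else p x k.
have qv k : q v k = (p a k + p b k) / 2 by rewrite /q eqxx.
have qW x : x \in W -> q x = p x.
  by move=> xW; rewrite /q; case: eqP xW vW => [-> -> //|].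
have qF : rig_mx q (induced_rel g W) = rig_mx p (induced_rel g W).
  apply/row_matrixP => i; rewrite !rowK /=; case: ifP => // /and3P[xW yW _].
  by apply: eq_rig_row; rewrite qW.
apply: leq_trans (generic_rig_rank q _ gp).
set C := rig_mx q _.
have nv x : x \in W -> x != v by move=> xW; apply: contraNneq vW => <-.
have bW : b \in W by rewrite -si0.
have vaC : (rig_row q v a <= C)%MS.
  by apply: rig_row_sub; rewrite /induced_rel !inE eqxx aW orbT.
have vsC i : (rig_row q v (s i) <= C)%MS.
  by apply: rig_row_sub; rewrite /induced_rel !inE eqxx sW orbT /= gvs.
have abE : rig_row p a b = 2 *: (rig_row q v a + rig_row q v b).
  rewrite -linearD -linearZ; congr mxvec; apply/matrixP => i k.
  by rewrite !mxE !qv !qW //; field.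
have abC : (rig_row p a b <= C)%MS.
  by rewrite abE scalemx_sub // addmx_sub // -si0.
rewrite -addn1 [(d + 1)%N]addnC addnA.
(* The row ab is new, which gives one, and it vanishes on the columns of [v], so the star at [v]
   still adds [d]. *)
apply: (@leq_trans (\rank (rig_mx p (induced_rel g W) + rig_row p a b)%MS + d)).
  rewrite leq_add2r addn1 ltn_neqAle mxrankS ?addsmxSl // andbT.
  apply: contra abN => /eqP rE; apply: submx_trans (addsmxSr (rig_mx p (induced_rel g W)) _) _.
  by rewrite -(geq_leqif (mxrank_leqif_sup (addsmxSl _ _))) rE.
apply: (rank_add_star (q := q) (s := s) (v := v)) => //.
- apply/eqP; rewrite -submx0 addsmxMr addsmx_sub induced_proj0 // sub0mx /=.
  rewrite submx0; apply/eqP/rowP => j.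
  rewrite rig_row_proj ![v == _]eq_sym (negPf (nv _ aW)) (negPf (nv _ bW)).
  by rewrite subrr mul0r mxE.
- by move=> i; exact: nv.
- have afree : row_free (diff_mx p a s) by apply: generic_diff_free.
  (* With [v] the midpoint of a and b, (v - s i) + (v - b) = a - s i; hence the rows at [v] span
     those at [a], which are free by genericity. *)
  suff sub : (diff_mx p a s <= diff_mx q v s)%MS.
    by rewrite /row_free eqn_leq rank_leq_row -{1}(eqP afree) mxrankS.
  apply/row_subP => i.
  have -> : row i (diff_mx p a s) = row i (diff_mx q v s) + row i0 (diff_mx q v s).
    by apply/rowP => j; rewrite !mxE !qv si0 !qW // ; field.
  by rewrite addmx_sub ?row_sub.
- rewrite addsmx_sub abC andbT -qF; exact/rig_mx_sub/induced_sub/subsetUr.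
Qed.

End Extensions.

Section Clique.
Variables (R : realType) (T : finType) (d : nat).
Implicit Types (p q u : T -> 'I_d -> R) (F : rel T).

Lemma strainC q u x y : strain q u x y = strain q u y x.
Proof. by apply: eq_bigr => k _; rewrite -mulrNN !opprB. Qed.

Lemma strain_dot q u x y :
  strain q u x y = ((\row_k (q x k - q y k)) *m (\row_k (u x k - u y k))^T) 0 0.
Proof. by rewrite mxE; apply: eq_bigr => k _; rewrite !mxE. Qed.

Lemma mul_skew_row n (K : 'M[R]_n) (a : 'rV[R]_n) : K^T = - K -> a *m K *m a^T = 0.
Proof.
move=> Ks; set x := a *m K *m a^T.
have xT : x^T = - x by rewrite /x !trmx_mul trmxK Ks mulNmx mulmxN mulmxA.
apply/matrixP => i j; move/matrixP: xT => /(_ j i); rewrite !mxE !ord1; lra.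
Qed.

(* On the clique {z, s i} a motion acts as a skew map S about z; the d bars from
   y then force the velocity of y to be the one given by S. *)
Lemma double_cone_strain q u y z (s : 'I_d -> T) :
  row_free (diff_mx q z s) -> row_free (diff_mx q y s) ->
  (forall i j, i != j -> strain q u (s i) (s j) = 0) ->
  (forall i, strain q u z (s i) = 0) -> (forall i, strain q u y (s i) = 0) ->
  strain q u y z = 0.
Proof.
rewrite !row_free_unit => zU yU ss zs ys.
set M := diff_mx q z s in zU; set N := diff_mx q y s in yU.
pose W := diff_mx u z s.
pose my : 'rV[R]_d := \row_k (q z k - q y k).
pose wy : 'rV[R]_d := \row_k (u z k - u y k).
have MWii i : (M *m W^T) i i = 0.
  by rewrite -[RHS](zs i) mxE; apply: eq_bigr => k _; rewrite !mxE.
(* Equivalently, the linear map taking each row of [M] to the corresponding row of [W] is skew. *)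
have skew : (W *m M^T)^T = - (W *m M^T).
  apply/matrixP => i j; rewrite trmx_mul trmxK.
  have [->|ij] := eqVneq i j.
    have -> : W *m M^T = (M *m W^T)^T by rewrite trmx_mul trmxK.
    by rewrite [in RHS]mxE [in RHS]mxE !MWii oppr0.
  have h : strain q u (s i) (s j) = (M *m W^T) i i + (M *m W^T) j j
       - (M *m W^T) i j - (W *m M^T) i j.
    rewrite !mxE -big_split /= -!sumrB.
    by apply: eq_bigr => k _; rewrite !mxE; ring.
  move: h; rewrite ss // !MWii [RHS in _ -> _ = RHS]mxE; lra.
(* [al] holds the coordinates of z - y in the basis z - s i. The skew map predicts [al *m W] for the
   velocity difference, and [e0] confirms it by testing against the rows of the invertible [N]. *)
pose al := my *m invmx M.
have myE : my = al *m M by rewrite mulmxKV.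
have e0 : wy - al *m W = 0.
  apply: (can_inj (mulmxK (_ : N^T \in unitmx))); first by rewrite unitmx_tr.
  rewrite mul0mx; apply/rowP => i; rewrite mxE [RHS]mxE.
  have h1 : \sum_k wy 0 k * N i k = - (my *m W^T) 0 i.
    have h : strain q u y (s i) = (M *m W^T) i i - \sum_k wy 0 k * N i k - (my *m W^T) 0 i.
      rewrite !mxE -!sumrB.
      by apply: eq_bigr => k _; rewrite !mxE; ring.
    by move: h; rewrite ys MWii; lra.
  have h2 : \sum_k (al *m W) 0 k * N i k = - (my *m W^T) 0 i.
    have -> : \sum_k (al *m W) 0 k * N i k = (al *m W *m M^T) 0 i - (al *m W *m my^T) 0 0.
      rewrite ![(al *m W *m _) _ _]mxE -sumrB; apply: eq_bigr => k _.
      by rewrite !mxE; ring.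
    rewrite {1}myE trmx_mul mulmxA -[al *m W *m M^T]mulmxA mul_skew_row //.
    rewrite [X in _ - X]mxE subr0.
    have -> : W *m M^T = - (M *m W^T) by rewrite -[LHS]opprK -skew trmx_mul trmxK.
    by rewrite mulmxN mulmxA -myE mxE.
  rewrite -[RHS](subrr (- (my *m W^T) 0 i)) -{1}h1 -h2 -sumrB.
  by apply: eq_bigr => k _; rewrite !mxE; ring.
move/eqP: e0; rewrite subr_eq0 => /eqP wyE.
rewrite strainC strain_dot -/my -/wy wyE myE trmx_mul mulmxA.
have -> : al *m M *m W^T *m al^T = - (al *m (W *m M^T) *m al^T).
  have -> : W *m M^T = - (M *m W^T) by rewrite -[LHS]opprK -skew trmx_mul trmxK.
  by rewrite mulmxN mulNmx opprK !mulmxA.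
by rewrite mul_skew_row // oppr0 mxE.
Qed.

Lemma double_cone p F y z (s : 'I_d -> T) :
  generic p -> injective s -> (forall i, s i != y) -> (forall i, s i != z) ->
  (forall i j, i != j -> (rig_row p (s i) (s j) <= rig_mx p F)%MS) ->
  (forall i, (rig_row p y (s i) <= rig_mx p F)%MS) ->
  (forall i, (rig_row p z (s i) <= rig_mx p F)%MS) ->
  (rig_row p y z <= rig_mx p F)%MS.
Proof.
move=> gp sI sy sz ss ys zs; apply/rig_row_subP => u Fu.
apply: (@double_cone_strain _ _ _ _ s); try exact: generic_diff_free.
- by move=> i j /ss /rig_row_subP; exact.
- by move=> i; have /rig_row_subP := zs i; exact.
- by move=> i; have /rig_row_subP := ys i; exact.
Qed.

Lemma rig_row_refl q x : rig_row q x x = 0.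
Proof.
rewrite /rig_row (_ : \matrix_(i, k) _ = 0) ?linear0 //.
by apply/matrixP => i k; rewrite !mxE !subrr mul0r.
Qed.

Lemma rank_rig_mx_card q F : (\rank (rig_mx q F) <= #|[set xy | F xy.1 xy.2]|)%N.
Proof.
have sub : (rig_mx q F <= \sum_(xy in [set xy | F xy.1 xy.2]) <<rig_row q xy.1 xy.2>>)%MS.
  apply: rig_mx_subP => x y Fxy.
  by rewrite (sumsmx_sup (x, y)) ?inE //= genmxE.
apply: leq_trans (mxrankS sub) _.
apply: leq_trans (mxrank_sum_leqif _).1 _ => /=.
rewrite -[X in (_ <= X)%N]sum1_card; apply: leq_sum => xy _ /=.
by rewrite genmxE rank_leq_row.
Qed.

End Clique.

Section Space.
Variables (R : realType) (T : finType).
Implicit Types (p q : T -> 'I_3 -> R) (F : rel T).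

Lemma tnth3_inj (a b c : T) : a != b -> a != c -> b != c -> injective (tnth [tuple a; b; c]).
Proof. by move=> ab ac bc; apply/tuple_uniqP; rewrite /= !inE negb_or ab ac bc. Qed.

Lemma tnth3P (P : T -> Prop) (a b c : T) :
  P a -> P b -> P c -> forall i : 'I_3, P (tnth [tuple a; b; c] i).
Proof. by move=> Pa Pb Pc [[|[|[|]]]]. Qed.

(** Counts a spanning set of rows instead of describing the trivial motions: the triangle abc and
    three bars from every other vertex to it, 3 + 3(n - 3) in all. [double_cone] yields the
    remaining pairs. *)
Lemma rank_complete_le p (a b c : T) : generic p -> a != b -> a != c -> b != c ->
  (\rank (rig_mx p (fun _ _ => true)) + 6 <= 3 * #|T|)%N.
Proof.
move=> gp ab ac bc.
pose t := [set a; b; c].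
have ct : #|t| = 3%N by rewrite /t setUC cardsU1 cards2 !inE negb_or ![c == _]eq_sym ab ac bc.
(* Each bar is listed in one direction only, because [rank_rig_mx_card] counts ordered pairs. *)
pose F0 : rel T := fun x y =>
  ((x, y) \in [set (a, b); (b, c); (c, a)]) || ((x \notin t) && (y \in t)).
have F0t x y : x \notin t -> y \in t -> F0 x y by rewrite /F0 => -> ->; rewrite orbT.
have rt x y : x \in t -> y \in t -> (rig_row p x y <= rig_mx p F0)%MS.
  have h1 : (rig_row p a b <= rig_mx p F0)%MS by apply: rig_row_sub; rewrite /F0 !inE !eqxx.
  have h2 : (rig_row p b c <= rig_mx p F0)%MS by apply: rig_row_sub; rewrite /F0 !inE !eqxx orbT.
  have h3 : (rig_row p c a <= rig_mx p F0)%MS by apply: rig_row_sub; rewrite /F0 !inE !eqxx !orbT.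
  rewrite !inE -!orbA => /or3P[] /eqP-> /or3P[] /eqP->;
    by rewrite ?rig_row_refl ?sub0mx // rig_rowC.
have sub : (rig_mx p (fun _ _ => true) <= rig_mx p F0)%MS.
  apply: rig_mx_subP => x y _.
  have [xt|xt] := boolP (x \in t); have [yt|yt] := boolP (y \in t).
  - exact: rt.
  - by rewrite rig_rowC; apply: rig_row_sub; exact: F0t.
  - by apply: rig_row_sub; exact: F0t.
  have st i : tnth [tuple a; b; c] i \in t.
    by move: i; apply: (@tnth3P (fun x => x \in t)); rewrite !inE eqxx ?orbT.
  apply: (@double_cone _ _ _ _ _ _ _ (tnth [tuple a; b; c])) => //.
  - exact: tnth3_inj.
  - by move=> i; apply: contraNneq xt => <-.
  - by move=> i; apply: contraNneq yt => <-.
  - by move=> i j _; exact: rt.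
  - by move=> i; apply: rig_row_sub; exact: F0t.
  - by move=> i; apply: rig_row_sub; exact: F0t.
have := leq_trans (mxrankS sub) (rank_rig_mx_card p F0).
have : (#|[set xy | F0 xy.1 xy.2]| <= 3 + 3 * (#|T| - 3))%N.
  have -> : [set xy | F0 xy.1 xy.2] = [set (a, b); (b, c); (c, a)] :|: setX (~: t) t.
    by apply/setP => -[x y]; rewrite in_setU in_setX in_setC inE.
  apply: leq_trans (leq_card_setU _ _) _; rewrite leq_add //.
    by rewrite setUC cardsU1 cards2; case: (_ \notin _); case: (_ != _).
  by have := cardsC t; rewrite cardsX ct; lia.
have : (3 <= #|T|)%N by rewrite -ct max_card.
lia.
Qed.

End Space.

(** * From infinitesimal to continuous rigidity *)

Section GramDeterminant.
Variables (R : realType) (T : finType) (d : nat) (e : rel T).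
Implicit Types (p q u : T -> 'I_d -> R).

Lemma mulmx_tr_eq0 n (w : 'rV[R]_n) : w *m w^T = 0 -> w = 0.
Proof.
move=> /matrixP /(_ 0 0); rewrite !mxE => /eqP.
rewrite psumr_eq0 => [|i _]; last by rewrite !mxE -expr2 sqr_ge0.
move=> /allP w0; apply/rowP => i; have := w0 i (mem_index_enum _).
by rewrite !mxE -expr2 sqrf_eq0 => /eqP.
Qed.

Lemma det_gram_neq0 m n (B : 'M[R]_(m, n)) : (\det (B *m B^T) != 0) = row_free B.
Proof.
rewrite -unitfE -unitmxE -row_free_unit; apply/idP/idP => free; last first.
  apply: inj_row_free => v v0; apply: (row_free_inj free); rewrite mul0mx.
  by apply: mulmx_tr_eq0; rewrite trmx_mul mulmxA -[v *m B *m _]mulmxA v0 mul0mx.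
by apply: inj_row_free => v v0; apply: (row_free_inj free); rewrite mul0mx mulmxA v0 mul0mx.
Qed.

(** The inner product of two rigidity rows, written by polarisation in squared distances [delta]
    alone; the Gram determinant is therefore a congruence invariant. *)
Definition gram_entry (delta : T -> T -> R) (xy zw : T * T) : R :=
  let: (x, y) := xy in let: (z, w) := zw in
  ((x == z)%:R - (x == w)%:R - (y == z)%:R + (y == w)%:R) *
  ((delta x w + delta y z - delta x z - delta y w) / 2).

Lemma rig_row_gram q x y z w :
  rig_row q x y *m (rig_row q z w)^T =
  (gram_entry (fun a b => sqdist (q a) (q b)) (x, y) (z, w))%:M.
Proof.
pose u v k := ((v == z)%:R - (v == w)%:R) * (q z k - q w k).
have -> : rig_row q z w = motion_vec u by [].
rewrite rig_row_motion /strain /gram_entry; congr (_%:M).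
rewrite /sqdist -big_split -!sumrB /= mulr_suml mulr_sumr.
by apply: eq_bigr => k _; rewrite /u; field.
Qed.

Definition gram_mx r (f : 'I_r -> 'I_#|{: T * T}|) (delta : T -> T -> R) : 'M[R]_r :=
  \matrix_(i, j) (let xy := enum_val (f i) in let zw := enum_val (f j) in
    if e xy.1 xy.2 && e zw.1 zw.2 then gram_entry delta xy zw else 0).

Lemma gram_mxE r (f : 'I_r -> 'I_#|{: T * T}|) q :
  rowsub f (rig_mx q e) *m (rowsub f (rig_mx q e))^T =
  gram_mx f (fun a b => sqdist (q a) (q b)).
Proof.
apply/matrixP => i j.
have -> : (rowsub f (rig_mx q e) *m (rowsub f (rig_mx q e))^T) i j =
  (row (f i) (rig_mx q e) *m (row (f j) (rig_mx q e))^T) 0 0.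
  by rewrite !mxE; apply: eq_bigr => k _; rewrite !mxE.
rewrite !rowK [RHS]mxE.
case: (enum_val (f i)) => x y; case: (enum_val (f j)) => z w /=.
case: (e x y) => /=; last by rewrite mul0mx mxE.
case: (e z w) => /=; last by rewrite trmx0 mulmx0 mxE.
by rewrite rig_row_gram mxE eqxx mulr1n.
Qed.

Lemma strain_average (q q' : T -> 'I_d -> R) x y :
  strain (fun z k => (q z k + q' z k) / 2) (fun z k => q z k - q' z k) x y =
  (sqdist (q x) (q y) - sqdist (q' x) (q' y)) / 2.
Proof.
by rewrite /sqdist -sumrB mulr_suml; apply: eq_bigr => k _; field.
Qed.

End GramDeterminant.

Section Convergence.
Local Open Scope classical_set_scope.
Variables (R : realType) (U : Type) (F : set_system U).
Context {FF : Filter F}.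

Lemma cvg_det n (M : U -> 'M[R]_n) (M0 : 'M[R]_n) :
  (forall i j, M t i j @[t --> F] --> M0 i j) -> \det (M t) @[t --> F] --> \det M0.
Proof.
move=> MM; apply: cvg_big => [|s _]; first exact: add_continuous.
apply: cvgM; first exact: cvg_cst.
by apply: cvg_big => [|i _]; [exact: mul_continuous | exact: MM].
Qed.

Lemma cvg_sqdist d (a b : U -> 'I_d -> R) (a0 b0 : 'I_d -> R) :
  (forall k, a t k @[t --> F] --> a0 k) -> (forall k, b t k @[t --> F] --> b0 k) ->
  sqdist (a t) (b t) @[t --> F] --> sqdist a0 b0.
Proof.
move=> aa bb; apply: cvg_big => [|k _]; first exact: add_continuous.
by apply: cvgM; apply: cvgB; [exact: aa | exact: bb | exact: aa | exact: bb].
Qed.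

End Convergence.

Section Within.
Local Open Scope classical_set_scope.

Lemma within_cvg (R : realType) (A : set R) (f : R -> R) s :
  {within A, continuous f} -> A s -> f t @[t --> within A (nbhs s)] --> f s.
Proof. by move=> fc As; have := fc s; rewrite /continuous_at /nbhs /= -nbhs_subspace_in. Qed.

End Within.

Section InfinitesimalRigidity.
Local Open Scope classical_set_scope.
Variables (R : realType) (T : finType) (d : nat) (e : rel T).
Implicit Types (p q : T -> 'I_d -> R).

(** Phrased with the rows of the complete graph, which avoids describing trivial motions and
    dimension counts. *)
Definition inf_rigid q := forall x y, (rig_row q x y <= rig_mx q e)%MS.

Definition congruent q q' := forall x y, sqdist (q x) (q y) = sqdist (q' x) (q' y).

Lemma inf_rigid_average q q' :
  inf_rigid (fun z k => (q z k + q' z k) / 2) ->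
  (forall x y, e x y -> sqdist (q x) (q y) = sqdist (q' x) (q' y)) -> congruent q q'.
Proof.
move=> rig edges x y.
have /rig_row_subP /(_ (fun z k => q z k - q' z k)) := rig x y.
rewrite strain_average => H; apply/eqP; rewrite -subr_eq0.
have : (sqdist (q x) (q y) - sqdist (q' x) (q' y)) / 2 = 0.
  by apply: H => a b /edges ab; rewrite strain_average ab subrr mul0r.
by move/eqP; rewrite mulf_eq0 invr_eq0 pnatr_eq0 orbF.
Qed.

(** Take a row basis at [p]. Where its Gram determinant is nonzero these rows stay free, and they
    still span the rows of the complete graph, whose rank at [q] cannot exceed the one at the
    generic [p]. *)
Lemma inf_rigid_gram p : generic p -> inf_rigid p ->
  exists r (f : 'I_r -> 'I_#|{: T * T}|),
    \det (gram_mx e f (fun a b => sqdist (p a) (p b))) != 0 /\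
    forall q, \det (gram_mx e f (fun a b => sqdist (q a) (q b))) != 0 -> inf_rigid q.
Proof.
move=> gp rigp; exists (\rank (rig_mx p e)), (maxrankfun (rig_mx p e)).
split=> [|q]; rewrite -gram_mxE det_gram_neq0; first exact: maxrowsub_free.
move=> free x y.
have rp : (\rank (rig_mx p (fun _ _ => true)) <= \rank (rig_mx p e))%N.
  by apply: mxrankS; apply: rig_mx_subP => a b _; exact: rigp.
have sub : (rig_mx q e <= rig_mx q (fun _ _ => true))%MS by apply: rig_mx_sub.
have rq : (\rank (rig_mx q (fun _ _ => true)) <= \rank (rig_mx q e))%N.
  apply: leq_trans (generic_rig_rank q _ gp) (leq_trans rp _).
  rewrite -[X in (X <= _)%N](eqP free); exact/mxrankS/rowsub_sub.
apply: submx_trans (_ : rig_mx q (fun _ _ => true) <= _)%MS; first exact: rig_row_sub.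
by rewrite -(geq_leqif (mxrank_leqif_sup sub)).
Qed.

(* Being congruent to p is a clopen condition on the parameter of a motion: the
   Gram determinant depends only on distances, so it is nonzero at the averages
   of P t and P s for t near s, and inf_rigid_average applies. *)
Lemma inf_rigid_rigid p : generic p -> inf_rigid p -> framework_rigid e p.
Proof.
move=> gp rigp P [Pc P0 Pe [t1 [x1 [y1 [At1]]]]]; apply/negP; rewrite negbK; apply/eqP.
have [r [f [Dp Dq]]] := inf_rigid_gram gp rigp.
pose A : set R := @unit_interval R.
pose B := A `&` [set t | congruent (P t) p].
have cvgP s x k : A s -> P t x k @[t --> within A (nbhs s)] --> P s x k.
  by move=> As; exact: (within_cvg (Pc x k) As).
suff BA : B = A.
  have [_ cong] : B t1 by rewrite BA.
  exact: cong.
have := @segment_connected R 0 1; apply.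
- exists 0; split; first by rewrite /A /unit_interval /= in_itv /= lexx ler01.
  by rewrite /= P0.
- exists [set t | A t -> congruent (P t) p]°; first exact: open_interior.
  apply/seteqP; split => s [As]; last by move=> /interior_subset Cs; split => //; exact: Cs.
  move=> Cs; split => //.
  have Ds : \det (gram_mx e f (fun a b => sqdist (P s a) (P s b))) != 0.
    by rewrite (_ : (fun a b => _) = fun a b => sqdist (p a) (p b)) //;
      apply/funext => a; apply/funext => b; exact: Cs.
  pose m t z k : R := (P t z k + P s z k) / 2.
  have ms : m s = P s by apply/funext => z; apply/funext => k; rewrite /m; field.
  have mc z k : m t z k @[t --> within A (nbhs s)] --> m s z k.
    apply: cvgM; last exact: cvg_cst.
    by apply: cvgD; [exact: cvgP | exact: cvg_cst].
  have : \forall t \near within A (nbhs s),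
      \det (gram_mx e f (fun a b => sqdist (m t a) (m t b))) != 0.
    apply: (@cvgr_neq0 _ _ _ _ _ _ (\det (gram_mx e f (fun a b => sqdist (m s a) (m s b))))).
      apply: cvg_det => i j; rewrite /gram_mx !mxE.
      under eq_cvg do rewrite mxE.
      case: ifP => _; last exact: cvg_cst.
      case: (enum_val (f i)) => x y; case: (enum_val (f j)) => z w /=.
      have sc a b : sqdist (m t a) (m t b) @[t --> within A (nbhs s)] --> sqdist (m s a) (m s b).
        by apply: cvg_sqdist => k; exact: mc.
      apply: cvgM; first exact: cvg_cst.
      apply: cvgM; last exact: cvg_cst.
      by apply: cvgB; [apply: cvgB; [apply: cvgD|]|].
    by rewrite ms.
  rewrite near_withinE => near_det; rewrite /interior /=; move: near_det.
  apply: (@filterS R (nbhs s)) => t Dt At.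
  have cong : congruent (P t) (P s).
    apply: inf_rigid_average; first by apply: Dq; exact: Dt.
    by move=> x y exy; rewrite (Pe t) // (Pe s).
  by move=> x y; rewrite cong Cs.
- exists (closure B); first exact: closed_closure.
  apply/seteqP; split => s [As]; first by move=> Cs; split => //; apply: subset_closure.
  move=> Bs; split => //.
  move=> x y; apply: contrapT => /eqP neq.
  have sc : sqdist (P t x) (P t y) @[t --> within A (nbhs s)] --> sqdist (P s x) (P s y).
    by apply: cvg_sqdist => k; exact: cvgP.
  have : \forall t \near within A (nbhs s), sqdist (P t x) (P t y) - sqdist (p x) (p y) != 0.
    apply: (@cvgr_neq0 _ _ _ _ _ _ (sqdist (P s x) (P s y) - sqdist (p x) (p y))).
      by apply: cvgB => //; exact: cvg_cst.
    by rewrite subr_eq0.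
  move=> /Bs [t [[At Ct]]] /(_ At).
  by rewrite Ct subrr eqxx.
Qed.

End InfinitesimalRigidity.

(** * Expected rank increments *)

Section Averaging.
Variables (T : finType) (g : rel T) (inc phi : {set T} -> rat) (rk : {set T} -> nat).
Definition nbr (x : T) : {set T} := [set y | g x y].

Hypothesis g_irr : ssrbool.irreflexive g.
Hypothesis phi_rec : forall S : {set T},
  (#|S|.+1)%:R * phi S <= inc S + \sum_(u in S) phi (S :\ u).
Hypothesis rk_inc : forall (W : {set T}) v, v \notin W ->
  (rk W)%:R + inc (nbr v :&: W) <= (rk (v |: W))%:R :> rat.

(** Linearity of expectation for a random order, without forming an expectation: the induction
    averages over the last vertex of [W], and [phi_rec] conditions on which element of S and v
    itself comes last. *)
Lemma sum_phi_le_rank (W : {set T}) : \sum_(v in W) phi (nbr v :&: W) <= (rk W)%:R.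
Proof.
elim: {W}#|W| {-2}W (erefl #|W|) => [|m IH] W cW.
  by rewrite (cards0_eq cW) big_set0.
have step w : w \in W ->
    \sum_(v in W :\ w) phi ((nbr v :&: W) :\ w) + inc (nbr w :&: W) <= (rk W)%:R.
  move=> wW; have := @rk_inc (W :\ w) w; rewrite !inE eqxx setD1K // => /(_ isT).
  apply: le_trans; apply: lerD.
    have cWw : #|W :\ w| = m by move: cW; rewrite (cardsD1 w) wW => -[].
    have := IH (W :\ w) cWw; apply: le_trans.
    by apply: ler_sum => v _; rewrite setIDA.
  have -> // : nbr w :&: (W :\ w) = nbr w :&: W.
  by apply/setP => x; rewrite !inE; case: eqP => [->|]; rewrite ?g_irr.
have m1 : (0 : rat) < m.+1%:R by rewrite ltr0n.
rewrite -(ler_pM2l m1).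
have -> : m.+1%:R * (rk W)%:R = \sum_(w in W) (rk W)%:R :> rat.
  by rewrite sumr_const cW mulr_natl.
apply: le_trans (ler_sum _ step); rewrite big_split /=.
have -> : \sum_(w in W) \sum_(v in W :\ w) phi ((nbr v :&: W) :\ w)
   = \sum_(v in W) \sum_(w in W :\ v) phi ((nbr v :&: W) :\ w).
  rewrite (exchange_big_dep (mem W)) /= => [|i j _]; last by rewrite inE => /andP[].
  apply: eq_bigr => v vW; apply: eq_bigl => w; rewrite !inE vW andbT eq_sym.
  by rewrite andbC.
rewrite -big_split mulr_sumr; apply: ler_sum => v vW.
set S := nbr v :&: W.
have vS : v \notin S by rewrite !inE g_irr.
have SW : S \subset W :\ v.
  by apply/subsetP => x xS; rewrite in_setD1 (contraNneq _ vS) => [|<- //]; case/setIP: xS.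
have c : #|W :\ v| = m by have := cardsD1 v W; rewrite vW cW => -[].
have Sm : (#|S| <= m)%N by rewrite -c subset_leq_card.
(* A last vertex in [S] shrinks the neighbourhood of [v]; each of the m - |S| others leaves it
   unchanged. *)
rewrite (bigID (mem S)) /=.
have -> : \sum_(w in W :\ v | w \in S) phi (S :\ w) = \sum_(w in S) phi (S :\ w).
  by apply: eq_bigl => w; rewrite andbC andb_idr // => /(subsetP SW).
have -> : \sum_(w in W :\ v | w \notin S) phi (S :\ w) = (m - #|S|)%:R * phi S.
  rewrite (eq_bigr (fun=> phi S)) => [|w /andP[_ wS]].
    rewrite sumr_const mulr_natl; congr GRing.natmul.
    rewrite -c -(cardsID S (W :\ v)) (setIidPr SW) addKn.
    by apply: eq_card => w; rewrite [RHS]in_setD andbC.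
  congr phi; apply/setP => x; rewrite !in_setD1 andb_idl // => xS.
  by apply: contraNneq wS => <-.
rewrite natrB //; have := phi_rec S; rewrite -!natr1; lra.
Qed.

End Averaging.

Lemma deg_nbr (T : finType) (g : rel T) x : deg g x = #|nbr g x|.
Proof.
by apply: eq_card => y; rewrite [RHS]inE; apply/idP/idP => [/set_mem | gxy]; last exact: mem_set.
Qed.

(** * Consequences of the degree condition *)

Section Ore.
Variables (T : finType) (g : rel T).
Hypotheses (g_sym : ssrbool.symmetric g) (g_irr : ssrbool.irreflexive g).
Hypothesis ore : forall u v : T, u != v -> ~~ g u v -> (deg g u + deg g v >= #|T|.+1)%N.

(** The two neighbourhoods miss u and v, so their union has at most n - 2 elements, while their
    sizes add up to at least n + 1. *)
Lemma common_nbrs u v : u != v -> ~~ g u v -> (3 <= #|nbr g u :&: nbr g v|)%N.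
Proof.
move=> uv guv; have := ore uv guv; rewrite !deg_nbr.
have : (#|nbr g u :|: nbr g v| + 2 <= #|T|)%N.
  have <- : #|[set u; v]| = 2%N by rewrite cards2 uv.
  have := cardsC (nbr g u :|: nbr g v).
  have : [set u; v] \subset ~: (nbr g u :|: nbr g v).
    by apply/subsetP => x; rewrite !inE => /orP[] /eqP ->;
      rewrite g_irr ?(g_sym v) (negPf guv).
  by move=> /subset_leq_card; lia.
by have := cardsUI (nbr g u) (nbr g v); lia.
Qed.

Hypothesis incomplete : exists x y, x != y /\ ~~ g x y.

Lemma card_ge5 : (5 <= #|T|)%N.
Proof.
have [x [y [xy gxy]]] := incomplete.
have := common_nbrs xy gxy; have := ore xy gxy; rewrite !deg_nbr.
have := cardsUI (nbr g x) (nbr g y).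
have := cardsC (nbr g x :|: nbr g y).
have : [set x; y] \subset ~: (nbr g x :|: nbr g y).
  apply/subsetP => z; rewrite !inE => /orP[] /eqP ->;
      by rewrite g_irr ?(g_sym y) (negPf gxy).
have := subset_leq_card (subset_trans (subsetIl (nbr g x) (nbr g y)) (subsetUl _ (nbr g y))).
move=> ? /subset_leq_card; rewrite cards2 xy; lia.
Qed.

Lemma deg_ge3 v : (3 <= deg g v)%N.
Proof.
have [/existsP[y /andP[vy gvy]] | all] := boolP [exists y, (v != y) && ~~ g v y].
  rewrite deg_nbr; exact: leq_trans (common_nbrs vy gvy) (subset_leq_card (subsetIl _ _)).
have : ~: [set v] \subset nbr g v.
  apply/subsetP => y; rewrite !inE eq_sym => vy.
  by apply: contraNT all => gvy; apply/existsP; exists y; rewrite vy.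
move=> /subset_leq_card; rewrite -deg_nbr.
have := cardsC [set v]; have := card_ge5; rewrite cards1; lia.
Qed.

End Ore.

Section Clique.
Variables (T : finType) (g : rel T).

Definition clique (S : {set T}) := [forall x in S, forall y in S, (x != y) ==> g x y].

Lemma cliqueP (S : {set T}) :
  reflect (forall x y, x \in S -> y \in S -> x != y -> g x y) (clique S).
Proof.
apply: (iffP forall_inP) => [H x y xS yS xy | H x xS].
  by have /forall_inP /(_ _ yS) /implyP := H x xS; apply.
by apply/forall_inP => y yS; apply/implyP; exact: H.
Qed.

Lemma clique_sub (S S' : {set T}) : S' \subset S -> clique S -> clique S'.
Proof. by move=> /subsetP s /cliqueP H; apply/cliqueP => x y /s xS /s; exact: H. Qed.

Lemma three_in (S : {set T}) : (3 <= #|S|)%N ->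
  exists a b c, [/\ a \in S, b \in S, c \in S & [&& a != b, a != c & b != c]].
Proof.
rewrite cardE; case E : (enum S) (enum_uniq S) => [|a [|b [|c r]]] //= + _.
have m x : x \in enum S -> x \in S by rewrite mem_enum.
rewrite !inE !negb_or => /and4P[/and3P[ab ac _] /andP[bc _] _ _].
exists a, b, c; split; last by rewrite ab ac bc.
all: by apply: m; rewrite E !inE eqxx ?orbT.
Qed.

End Clique.

(** * Graphs in which two vertices joined to a common triangle are adjacent *)

Section Closed.
Variables (T : finType) (g : rel T).
Hypotheses (g_sym : ssrbool.symmetric g) (g_irr : ssrbool.irreflexive g).
Hypothesis g_closed : forall a b c y z, g a b -> g a c -> g b c ->
  g y a -> g y b -> g y c -> g z a -> g z b -> g z c -> y != z -> g y z.

Lemma common_clique (K : {set T}) y z : clique g K -> (3 <= #|K|)%N ->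
  (forall x, x \in K -> g y x && g z x) -> y != z -> g y z.
Proof.
move=> /cliqueP clK /three_in[a [b [c [aK bK cK /and3P[ab ac bc]]]]] KK.
have /andP[ya za] := KK _ aK; have /andP[yb zb] := KK _ bK; have /andP[yc zc] := KK _ cK.
by apply: (g_closed (a := a) (b := b) (c := c)) => //; exact: clK.
Qed.

(** Otherwise u and w are both joined to the clique left after removing them, which has at least
    three vertices; so u and w are adjacent and [S] is a clique. *)
Lemma at_most_one_clique_facet (S : {set T}) u w : (4 < #|S|)%N -> ~~ clique g S ->
  u \in S -> w \in S -> clique g (S :\ u) -> clique g (S :\ w) -> u = w.
Proof.
move=> S4 Sn uS wS cu cw; apply: contraNeq Sn => uw.
have guw : g u w.
  apply: (@common_clique (S :\ u :\ w)) => //.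
  - by apply: clique_sub cu; exact: subsetDl.
  - have := cardsD1 w (S :\ u); have := cardsD1 u S.
    by rewrite uS in_setD1 eq_sym uw wS; lia.
  - move=> x; rewrite !in_setD1 => /and3P[xw xu xS].
    move/cliqueP: cu => cu; move/cliqueP: cw => cw.
    have wu : w != u by rewrite eq_sym.
    have ux : u != x by rewrite eq_sym.
    have wx : w != x by rewrite eq_sym.
    by rewrite cw ?cu // in_setD1 ?uw ?wu ?xu ?xw.
apply/cliqueP => x y xS yS xy.
have [xu|xu] := eqVneq x u; have [yu|yu] := eqVneq y u.
- by rewrite xu yu eqxx in xy.
- have [yw|yw] := eqVneq y w; first by rewrite xu yw.
  by apply: (elimT (cliqueP _ _) cw) => //; rewrite in_setD1 ?yw // xu uw.
- have [xw|xw] := eqVneq x w; first by rewrite yu xw g_sym.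
  by apply: (elimT (cliqueP _ _) cw) => //; rewrite in_setD1 ?xw // yu uw.
- by apply: (elimT (cliqueP _ _) cu) => //; rewrite in_setD1 ?xu ?yu.
Qed.

Definition increment (S : {set T}) : rat :=
  if (3 < #|S|)%N && ~~ clique g S then 4 else (minn 3 #|S|)%N%:R.

(* A lower bound for the mean of increment over the random set of those
   neighbours in S that precede the vertex in a uniformly random order; its worst
   case is a clique on all but one element of S. *)
Definition mean_increment (S : {set T}) : rat :=
  if (#|S| < 3)%N then #|S|%:R / 2 else
  if clique g S then 3 - 6 / #|S|.+1%:R else 7 / 2 - 6 / #|S|%:R.

(** For a clique, 3 - 6/(d+1) is the mean of min(3, k) for k uniform on 0, ..., d. If every subset
    of size at least 4 containing one fixed element also gains 1, the extra mean is the sum of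
    k/(d(d+1)) over k = 4, ..., d, and the total is 7/2 - 6/d. *)
Lemma mean_increment_rec (S : {set T}) :
  #|S|.+1%:R * mean_increment S <= increment S + \sum_(u in S) mean_increment (S :\ u).
Proof.
have cD u : u \in S -> #|S :\ u| = #|S|.-1 by move=> uS; rewrite (cardsD1 u S) uS.
have sumc c : (forall u, u \in S -> mean_increment (S :\ u) = c) ->
    \sum_(u in S) mean_increment (S :\ u) = #|S|%:R * c.
  by move=> H; rewrite (eq_bigr (fun=> c)) // sumr_const mulr_natl.
rewrite /increment {1}/mean_increment.
have [s0|s0] := posnP #|S|.
  by rewrite s0 /= mul0r mulr0 add0r big1 // => u; rewrite (cards0_eq s0) inE.
have [s3|s3] := ltnP #|S| 3%N.
  rewrite (sumc (#|S|.-1%:R / 2)) => [|u uS]; last first.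
    by rewrite /mean_increment cD // (leq_ltn_trans (leq_pred _) s3).
  have -> : (3 < #|S|)%N = false by lia.
  by case: #|S| s0 s3 => [|[|[|]]] //=; rewrite /minn /=; lra.
have [s4|s4] := leqP #|S| 3%N.
  have s : #|S| = 3%N by lia.
  rewrite (sumc 1) => [|u uS]; last by rewrite /mean_increment cD // s.
  by rewrite s /minn /=; case: ifP => _; lra.
have sge : (4 : rat) <= #|S|%:R by rewrite ler_nat.
have f3 : (#|S|.-1 < 3)%N = false by lia.
have s1 : #|S|.-1%:R = #|S|%:R - 1 :> rat by rewrite -[in RHS](prednK s0) -natr1 addrK.
case: ifP => cS /=.
  rewrite (sumc (3 - 6 / #|S|%:R)) => [|u uS]; last first.
    by rewrite /mean_increment cD // f3 prednK // (clique_sub _ cS) ?subsetDl.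
  rewrite -natr1; set x : rat := #|S|%:R in sge *.
  have -> : (x + 1) * (3 - 6 / (x + 1)) = 3 * x - 3 by field; lra.
  have -> : x * (3 - 6 / x) = 3 * x - 6 by field; lra.
  lra.
have [s5|s5] := leqP #|S| 4%N.
  have s : #|S| = 4%N by lia.
  rewrite (sumc (3 / 2)) => [|u uS]; last first.
    (* At size 3 the clique and non-clique formulas agree, both being 3/2. *)
    by rewrite /mean_increment cD // s /=; case: ifP => _; lra.
  by rewrite s; lra.
set x : rat := #|S|%:R in sge s1 *.
have x5 : 5 <= x by rewrite ler_nat.
have nonc u : u \in S -> ~~ clique g (S :\ u) -> mean_increment (S :\ u) = 7 / 2 - 6 / (x - 1).
  by move=> uS /negPf nc; rewrite /mean_increment cD // f3 nc s1.
have lhs : #|S|.+1%:R * (7 / 2 - 6 / x) = 7 / 2 * x - 5 / 2 - 6 / x.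
  by rewrite -natr1 -/x; field; lra.
have xx : x / (x - 1) = 1 + (x - 1)^-1 by field; lra.
rewrite lhs.
have [/existsP[u0 /andP[u0S cu0]] | nex] := boolP [exists u, (u \in S) && clique g (S :\ u)].
  (* Exactly one facet is a clique: this case holds with equality. *)
  rewrite (bigD1 u0) //= (eq_bigr (fun=> 7 / 2 - 6 / (x - 1))) => [|u /andP[uS uu0]]; last first.
    apply: nonc => //; apply: contra uu0 => cu; apply/eqP.
    by apply: (at_most_one_clique_facet (S := S)) => //; rewrite cS.
  rewrite sumr_const.
  have -> : #|[pred u in S | u != u0]| = #|S|.-1.
    by rewrite -(cD u0) //; apply: eq_card => u; rewrite !inE andbC.
  have -> : mean_increment (S :\ u0) = 3 - 6 / x.
    by rewrite /mean_increment cD // f3 cu0 prednK.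
  have -> : (7 / 2 - 6 / (x - 1)) *+ #|S|.-1 = 7 / 2 * x - 19 / 2.
    by rewrite -mulr_natl s1; field; lra.
  lra.
rewrite (sumc (7 / 2 - 6 / (x - 1))) => [|u uS]; last first.
  by apply: nonc => //; apply: contra nex => cu; apply/existsP; exists u; rewrite uS.
have -> : x * (7 / 2 - 6 / (x - 1)) = 7 / 2 * x - 6 - 6 / (x - 1) by field; lra.
(* With no clique facet there is a surplus of 1/2, which covers 6/((x - 1)x), at most 6/20. *)
have i1 : (x - 1)^-1 - x^-1 = ((x - 1) * x)^-1 by field; lra.
have i2 : ((x - 1) * x)^-1 <= 20^-1 by rewrite lef_pV2 ?posrE; nra.
lra.
Qed.

Section Spanning.
Variable e : rel T.
Hypotheses (e_sym : ssrbool.symmetric e) (e_irr : ssrbool.irreflexive e).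
Hypothesis eg : subrel e g.
Hypothesis ore : forall u v : T, u != v -> ~~ e u v -> (deg e u + deg e v >= #|T|.+1)%N.
Hypothesis incomplete : exists x y, x != y /\ ~~ g x y.

Lemma incomplete_sub : exists x y, x != y /\ ~~ e x y.
Proof.
by have [x [y [xy gxy]]] := incomplete; exists x, y; split => //; apply: contra gxy; exact: eg.
Qed.

(** If the neighbourhood K of v were a clique, a vertex not adjacent to v would share three
    neighbours with v, all in K, and closure would join it in [g] to all of K. Then any two vertices
    have K in common and [g] is complete. *)
Lemma nbr_not_clique v : ~~ clique e (nbr e v).
Proof.
apply/negP => /cliqueP cv; set K := nbr e v in cv.
have cK : clique g K by apply/cliqueP => x y xK yK xy; apply: eg; exact: cv.
have K3 : (3 <= #|K|)%N by rewrite -deg_nbr; exact: (deg_ge3 e_sym e_irr ore incomplete_sub).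
have toK y k : k \in K -> y != k -> g y k.
  move=> kK yk; have [yv|yv] := eqVneq y v; first by apply: eg; rewrite yv; rewrite inE in kK.
  have [vy|vy] := boolP (e v y); first by apply: (elimT (cliqueP _ _) cK) => //; rewrite inE.
  have [ky|ky] := boolP (e y k); first exact: eg.
  apply: (@common_clique (K :&: nbr e y)) => //.
  - by apply: clique_sub cK; exact: subsetIl.
  - by apply: (common_nbrs e_sym e_irr ore (u := v) (v := y)) => //; rewrite eq_sym.
  - move=> x /setIP[xK]; rewrite inE => yx; rewrite (eg yx) /=.
    by apply: (elimT (cliqueP _ _) cK) => //; apply: contraNneq ky => ->.
have [x [y [xy]]] := incomplete; apply/negP; rewrite negbK.
have [yK|yK] := boolP (y \in K); first exact: toK.
have [xK|xK] := boolP (x \in K); first by rewrite g_sym toK // eq_sym.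
apply: (common_clique cK K3) => // k kK.
by rewrite !toK //; [apply: contraNneq yK => -> | apply: contraNneq xK => ->].
Qed.

End Spanning.

Hypothesis ore : forall u v : T, u != v -> ~~ g u v -> (deg g u + deg g v >= #|T|.+1)%N.
Hypothesis incomplete : exists x y, x != y /\ ~~ g x y.

Lemma sum_inv_deg (rk : {set T} -> nat) :
  (forall (W : {set T}) v, v \notin W ->
    (rk W)%:R + increment (nbr g v :&: W) <= (rk (v |: W))%:R :> rat) ->
  (rk setT + 7 <= 3 * #|T|)%N ->
  #|T|%:R + 14 <= \sum_v 12 / (deg g v)%:R :> rat.
Proof.
move=> rk_inc rkT.
have := sum_phi_le_rank g_irr mean_increment_rec rk_inc setT.
rewrite (eq_bigr (fun v => 7 / 2 - 6 / (deg g v)%:R)) => [|v _]; last first.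
  rewrite setIT /mean_increment (negPf (nbr_not_clique g_sym g_irr _ ore incomplete v)) //.
  by rewrite -deg_nbr ltnNge (deg_ge3 g_sym g_irr ore incomplete).
have -> : \sum_(v in [set: T]) (7 / 2 - 6 / (deg g v)%:R : rat)
   = 7 / 2 * #|T|%:R - (\sum_v 12 / (deg g v)%:R) / 2.
  rewrite (eq_bigl predT) => [|v]; last by rewrite inE.
  rewrite sumrB sumr_const mulr_natr; congr (_ - _).
  by rewrite mulr_suml; apply: eq_bigr => v _; lra.
have : (rk setT)%:R + 7 <= 3 * #|T|%:R :> rat by rewrite -natrM -natrD ler_nat.
lra.
Qed.

End Closed.

(** * Degree sums *)

Section DegreeSum.
Variables (T : finType) (g : rel T).
Hypotheses (g_sym : ssrbool.symmetric g) (g_irr : ssrbool.irreflexive g).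
Hypothesis ore : forall u v : T, u != v -> ~~ g u v -> (deg g u + deg g v >= #|T|.+1)%N.
Hypothesis incomplete : exists x y, x != y /\ ~~ g x y.
Hypothesis nbr_nc : forall v, ~~ clique g (nbr g v).
Hypothesis deg3 : forall v, (3 <= deg g v)%N.
Hypothesis deg_sum : #|T|%:R + 14 <= \sum_v 12 / (deg g v)%:R :> rat.

Lemma inv_deg_le v m : (0 < m <= deg g v)%N -> 12 / (deg g v)%:R <= 12 / m%:R :> rat.
Proof.
move=> /andP[m0 mv]; rewrite ler_pM2l // lef_pV2 ?posrE ?ltr0n ?ler_nat //.
exact: leq_trans mv.
Qed.

Lemma sum_inv_deg_le (A : {set T}) m : (0 < m)%N -> (forall v, v \in A -> (m <= deg g v)%N) ->
  \sum_(v in A) 12 / (deg g v)%:R <= #|A|%:R * (12 / m%:R) :> rat.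
Proof.
move=> m0 H; rewrite mulr_natl -sumr_const; apply: ler_sum => v vA.
by apply: inv_deg_le; rewrite m0 H.
Qed.

Lemma sum_setT_eq : \sum_v 12 / (deg g v)%:R = \sum_(v in [set: T]) 12 / (deg g v)%:R :> rat.
Proof. by apply: eq_bigl => v; rewrite inE. Qed.

(** The degree sum gives m(n + 14) <= 12n, hence (n - 2)(n - 7) <= 0. For n = 6 the minimum m = 4
    already fails, and n = 7 is the equality case, so no degree can exceed 4. *)
Lemma high_min_deg m : (forall v, m <= deg g v)%N -> (#|T|.+1 <= 2 * m)%N ->
  [\/ #|T| = 5%N, #|T| = 7%N /\ (forall v, deg g v = 4%N) | (#|T| < 5)%N].
Proof.
move=> mm nm.
have m0 : (0 < m)%N by lia.
have := sum_inv_deg_le (A := [set: T]) m0 (fun v _ => mm v).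
rewrite -sum_setT_eq cardsT => sm.
have : (m * (#|T| + 14) <= 12 * #|T|)%N.
  have m0' : (0 : rat) < m%:R by rewrite ltr0n.
  rewrite -(ler_nat rat) !natrM natrD mulrC -ler_pdivlMr //.
  apply: le_trans (le_trans deg_sum sm) _; rewrite le_eqVlt; apply/orP; left; apply/eqP.
  by field; rewrite gt_eqF.
move=> mn.
have n7 : (#|T| <= 7)%N by nia.
have [n5|n5] := leqP #|T| 5.
  by move: n5; rewrite leq_eqVlt => /orP[/eqP|]; [constructor 1 | constructor 3].
have nE : #|T| = 7%N by nia.
have mE : m = 4%N by move: mn nm; rewrite nE; lia.
constructor 2; split => // v.
apply/eqP; rewrite eqn_leq -{2}mE mm andbT leqNgt; apply/negP => v5.
have := sum_inv_deg_le (A := [set~ v]) m0 (fun v _ => mm v).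
have c6 : #|[set~ v]| = 6%N by have := cardsC1 v; rewrite nE.
have d5 := @inv_deg_le v 5 v5.
have : \sum_v 12 / (deg g v)%:R = 12 / (deg g v)%:R + \sum_(w in [set~ v]) 12 / (deg g w)%:R :> rat.
  by rewrite (bigD1 v) //=; congr (_ + _); apply: eq_bigl => w; rewrite !inE.
move: deg_sum; rewrite c6 nE mE => h1 h2 h3; lra.
Qed.

(** * Minimum degree at most n/2: splitting at a vertex of minimum degree *)

Section LowDegree.
Variable x : T.
Let k := deg g x.
Hypothesis k_min : forall v, (k <= deg g v)%N.
Hypothesis k_low : (2 * k <= #|T|)%N.
Let N := nbr g x.
Let M := ~: (x |: N).

Lemma sum_split : \sum_v 12 / (deg g v)%:R =
  12 / k%:R + (\sum_(v in N) 12 / (deg g v)%:R + \sum_(v in M) 12 / (deg g v)%:R) :> rat.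
Proof.
rewrite (bigD1 x) //= (bigID (mem N)) /=; congr (_ + (_ + _)).
  apply: eq_bigl => v; rewrite andb_idl // => vN; apply: contraTneq vN => ->.
  by rewrite inE g_irr.
by apply: eq_bigl => v; rewrite !inE negb_or.
Qed.

Lemma card_N : #|N| = k. Proof. by rewrite /k deg_nbr. Qed.

Lemma card_M : (#|M| + k.+1 = #|T|)%N.
Proof.
by have := cardsC (x |: N); rewrite cardsU1 inE g_irr /= card_N /M; clear deg_sum k_low; lia.
Qed.

Lemma deg_M v : v \in M -> (#|T|.+1 - k <= deg g v)%N.
Proof.
rewrite !inE negb_or => /andP[vx gxv].
by rewrite leq_subLR /k; apply: ore => //; rewrite eq_sym.
Qed.

Lemma min_deg_ge3 : (3 <= k)%N. Proof. exact: deg3. Qed.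

Lemma sum_M_le : \sum_(v in M) 12 / (deg g v)%:R <=
  (#|T|.-1 - k)%:R * (12 / (#|T|.+1 - k)%:R) :> rat.
Proof.
have -> : (#|T|.-1 - k)%N = #|M| by rewrite -card_M addnS /= addnK.
apply: sum_inv_deg_le; last exact: deg_M.
by rewrite -card_M subn_gt0 ltnS addnS (leqW (leq_addl _ _)).
Qed.

(** [N] is not a clique, and of two non-adjacent vertices one has at least half of n + 1. *)
Lemma high_nbr : exists2 u, u \in N & (#|T|.+1 <= 2 * deg g u)%N.
Proof.
have := nbr_nc x; rewrite -/N => /forall_inPn[a aN /forall_inPn[b bN]].
rewrite negb_imply => /andP[ab gab]; have := ore ab gab.
have [ha|ha] := leqP #|T|.+1 (2 * deg g a)%N; first by exists a.
by exists b => //; lia.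
Qed.

Lemma sum_N_le m : (0 < m)%N -> (forall u, (#|T|.+1 <= 2 * deg g u)%N -> (m <= deg g u)%N) ->
  \sum_(v in N) 12 / (deg g v)%:R <= 12 / m%:R + (k.-1)%:R * (12 / k%:R) :> rat.
Proof.
move=> m0 mP; have [u uN /mP um] := high_nbr.
rewrite (bigD1 u) //=; apply: lerD; first by apply: inv_deg_le; rewrite m0.
have -> : k.-1 = #|N :\ u| by have := cardsD1 u N; rewrite uN card_N; lia.
have -> : \sum_(i in N | i != u) 12 / (deg g i)%:R = \sum_(i in N :\ u) 12 / (deg g i)%:R :> rat.
  by apply: eq_bigl => w; rewrite !inE andbC.
by apply: sum_inv_deg_le => //; have := min_deg_ge3; lia.
Qed.

(** The terms 12/k cancel, leaving 24 + 24/(n+1) - 24/(n+1-k) < 24 as a bound for a sum that is at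
    least n + 14. *)
Lemma low_lt10 : (#|T| < 10)%N.
Proof.
rewrite ltnNge; apply/negP => n10; have k3 := min_deg_ge3.
have n0 : (0 : rat) < #|T|.+1%:R by rewrite ltr0n.
have hN : \sum_(v in N) 12 / (deg g v)%:R <= 24 / #|T|.+1%:R + (k.-1)%:R * (12 / k%:R) :> rat.
  have [u uN hu] := high_nbr.
  apply: le_trans (sum_N_le (m := (#|T|.+1.+1)./2) _ _) _; [lia | by move=> w; lia |].
  rewrite lerD2r ler_pdivrMr ?ltr0n; last by lia.
  rewrite mulrAC ler_pdivlMr // -!natrM ler_nat; lia.
have hM := sum_M_le; move: deg_sum; rewrite sum_split.
move: hM.
have -> : (#|T|.-1 - k)%:R = (#|T|.+1 - k)%:R - 2 :> rat.
  by rewrite -natrB; [congr _%:R; lia | lia].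
set z : rat := (#|T|.+1 - k)%:R.
have z0 : 0 < z by rewrite ltr0n; lia.
have zn : z < #|T|.+1%:R by rewrite ltr_nat; lia.
have kk : (k.-1)%:R * (12 / k%:R) = 12 - 12 / k%:R :> rat.
  have k0 : (k%:R : rat) != 0 by rewrite pnatr_eq0; lia.
  have -> : (k.-1)%:R = k%:R - 1 :> rat.
    by rewrite -[in RHS](@prednK k) -?natr1 ?addrK //; lia.
  by field.
have -> : (z - 2) * (12 / z) = 12 - 24 / z by field; rewrite gt_eqF.
have : 24 / #|T|.+1%:R < 24 / z by rewrite ltr_pM2l // ltf_pV2 ?posrE.
have : (10 : rat) <= #|T|%:R by rewrite ler_nat.
rewrite kk in hN; move: hN.
move: (\sum_(v in N) _) (\sum_(v in M) _) (12 / k%:R) (24 / _) (24 / z) (#|T|%:R) => A B C D E F; lra.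
Qed.

(** The equations for [a], [b], [c] let each use supply numerals, so that linear arithmetic can
    decide the inequality. *)
Lemma low_bound n j a b c : #|T| = n -> k = j ->
  n.+2./2 = a -> (n.-1 - j)%N = b -> (n.+1 - j)%N = c ->
  n%:R + 14 <= 12 / j%:R + (12 / a%:R + (j.-1)%:R * (12 / j%:R) +
    b%:R * (12 / c%:R)) :> rat.
Proof.
move=> nE kE <- <- <-; rewrite -nE -kE; apply: le_trans deg_sum _; rewrite sum_split lerD2l.
apply: lerD; last exact: sum_M_le.
by apply: sum_N_le; [lia | move=> u; lia].
Qed.

(** The three common neighbours of x and y must be all of [N]. *)
Lemma adj_N_M u y : k = 3%N -> u \in N -> y \in M -> g y u.
Proof.
move=> kE uN; rewrite !inE negb_or => /andP[yx gxy].
have c3 := common_nbrs g_sym g_irr ore (_ : x != y) gxy.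
have /eqP NE : nbr g x :&: nbr g y == N.
  rewrite eqEcard subsetIl card_N kE; apply: c3; by rewrite eq_sym.
by move: uN; rewrite -NE !inE => /andP[].
Qed.

Lemma deg_N u : k = 3%N -> u \in N -> (#|T| - 3 <= deg g u)%N.
Proof.
move=> kE uN; rewrite deg_nbr.
have : x |: M \subset nbr g u.
  apply/subsetP => y; rewrite in_setU1 [y \in nbr _ _]inE g_sym => /predU1P[->|yM].
    by move: uN; rewrite inE.
  exact: adj_N_M.
move=> /subset_leq_card; rewrite cardsU1 !inE eqxx /=.
by have := card_M; rewrite kE; move: #|M| #|T| #|nbr g u| => *; clear deg_sum k_low; lia.
Qed.

(** Needed for k = 3 and n = 7 or 8, where [low_bound] is too weak (22.4 against the required 22 for
    n = 8): here all of [N] has degree at least n - 3. *)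
Lemma low_bound3 n a b c : #|T| = n -> k = 3%N -> (6 <= n)%N ->
  (n - 3)%N = a -> (n - 4)%N = b -> (n - 2)%N = c ->
  n%:R + 14 <= 4 + (3 * (12 / a%:R) + b%:R * (12 / c%:R)) :> rat.
Proof.
move=> nE kE n6 <- <- <-; rewrite -nE; apply: le_trans deg_sum _; rewrite sum_split.
apply: lerD; first by rewrite kE; lra.
apply: lerD.
  have := sum_inv_deg_le (A := N) (m := #|T| - 3) _ (fun u => deg_N kE).
  by rewrite card_N kE; apply; lia.
have := sum_M_le; rewrite kE.
by have -> : (#|T|.-1 - 3 = #|T| - 4)%N; [lia | have -> : (#|T|.+1 - 3 = #|T| - 2)%N by lia].
Qed.

Lemma low_min_deg : #|T| = 6%N /\ k = 3%N.
Proof.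
have k3 := min_deg_ge3; have n10 := low_lt10.
have k4 : k = 3%N \/ k = 4%N by lia.
have [n9|n9] := eqVneq #|T| 9%N.
  exfalso; case: k4 => kE.
    by have := low_bound n9 kE (erefl 5%N) (erefl 5%N) (erefl 7%N); rewrite /=; lra.
  by have := low_bound n9 kE (erefl 5%N) (erefl 4%N) (erefl 6%N); rewrite /=; lra.
have [n8|n8] := eqVneq #|T| 8%N.
  exfalso; case: k4 => kE.
    by have := low_bound3 n8 kE isT (erefl 5%N) (erefl 4%N) (erefl 6%N); lra.
  by have := low_bound n8 kE (erefl 5%N) (erefl 3%N) (erefl 5%N); rewrite /=; lra.
case: k4 => kE; last by lia.
have [n7|n7] := eqVneq #|T| 7%N.
  by exfalso; have := low_bound3 n7 kE isT (erefl 4%N) (erefl 3%N) (erefl 5%N); lra.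
by split => //; lia.
Qed.

End LowDegree.

Lemma degree_dichotomy : (5 <= #|T|)%N ->
  [\/ #|T| = 5%N, #|T| = 6%N /\ (exists x, deg g x = 3%N)
    | #|T| = 7%N /\ (forall v, deg g v = 4%N)].
Proof.
move=> n5; have [x0 _] := incomplete.
pose x := [arg min_(y < x0) deg g y].
have xmin v : (deg g x <= deg g v)%N.
  by rewrite /x; case: arg_minnP => // y _; exact.
have [low|high] := leqP (2 * deg g x) #|T|.
  have [n6 d3] := low_min_deg xmin low.
  by constructor 2; split => //; exists x.
case: (high_min_deg xmin high) => [n|[n d]|]; last by rewrite ltnNge n5.
  by constructor 1.
by constructor 3.
Qed.

End DegreeSum.

(** * The exceptional graphs *)

Section Exceptions.
Variables (T : finType) (g : rel T).
Hypotheses (g_sym : ssrbool.symmetric g) (g_irr : ssrbool.irreflexive g).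

Definition listed (del : seq (nat * nat)) (i j : nat) :=
  has (fun p : nat * nat => ((p.1 == i) && (p.2 == j)) || ((p.1 == j) && (p.2 == i))) del.

Lemma listedC del i j : listed del i j = listed del j i.
Proof. by apply: eq_has => p; rewrite orbC. Qed.

Lemma uniq_size_le (s : seq T) : uniq s -> (size s <= #|T|)%N.
Proof. by move=> us; rewrite -(card_uniqP us) max_card. Qed.

Lemma fresh (s : seq T) : (size s < #|T|)%N -> exists y, y \notin s.
Proof.
move=> sT; apply/existsP; rewrite -negb_forall; apply: contraTN sT => /forallP sx.
have /subset_leq_card : [set: T] \subset s by apply/fintype.subsetP.
by rewrite cardsT -leqNgt => /leq_trans; apply; exact: card_size.
Qed.

Lemma mem_spanning (s : seq T) x : uniq s -> size s = #|T| -> x \in s.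
Proof.
move=> us sT; apply: contraT => xs.
by have := @uniq_size_le (x :: s); rewrite /= xs us sT ltnn => /(_ isT).
Qed.

Lemma del_graph_iso n del (s : seq T) x0 : uniq s -> size s = n -> #|T| = n ->
  (forall i j, (i < j < n)%N -> g (nth x0 s i) (nth x0 s j) = ~~ listed del i j) ->
  graph_iso g (@del_graph n del).
Proof.
move=> us sn Tn H.
have ins x : x \in s by apply: mem_spanning => //; rewrite sn.
have ltn x : (index x s < n)%N by rewrite -sn index_mem.
exists (fun x => Ordinal (ltn x)); split.
  apply: inj_card_bij; last by rewrite card_ord Tn.
  move=> x y /(congr1 val) /= xy.
  by rewrite -(nth_index x0 (ins x)) xy nth_index.
move=> x y; rewrite /del_graph -val_eqE /= -/(listed del _ _).
rewrite -[in RHS](nth_index x0 (ins x)) -[in RHS](nth_index x0 (ins y)).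
case: ltngtP => [xy|yx|->] /=; last by rewrite g_irr.
  by rewrite H // xy ltn.
by rewrite g_sym listedC H // yx ltn.
Qed.

Hypothesis ore : forall u v : T, u != v -> ~~ g u v -> (deg g u + deg g v >= #|T|.+1)%N.
Hypothesis nbr_nc : forall v, ~~ clique g (nbr g v).

Lemma nonadjacent_nbrs v : exists a b, [/\ g v a, g v b, a != b & ~~ g a b].
Proof.
have /forall_inPn[a aN /forall_inPn[b bN]] := nbr_nc v.
rewrite negb_imply => /andP[ab gab]; exists a, b.
by move: aN bN; rewrite !inE.
Qed.

Lemma adj_neq x y : g x y -> x != y.
Proof. by apply: contraTneq => ->; rewrite g_irr. Qed.

(** Two non-adjacent vertices have all three others as common neighbours, so non-edges are disjoint.
    Besides uv there is a non-edge ab among the neighbours of u; the fifth vertex is the apex. *)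
Lemma iso_W5 u v : #|T| = 5%N -> u != v -> ~~ g u v -> graph_iso g W5.
Proof.
move=> T5 uv guv.
have full p q x : p != q -> ~~ g p q -> x != p -> x != q -> g p x && g q x.
  move=> pq gpq xp xq; suff : x \in nbr g p :&: nbr g q by rewrite !inE.
  suff -> : nbr g p :&: nbr g q = ~: [set p; q] by rewrite !inE negb_or xp xq.
  apply/eqP; rewrite eqEcard; apply/andP; split.
    apply/subsetP => z; rewrite !inE negb_or => /andP[pz qz].
    by rewrite !(eq_sym z) !adj_neq.
  have := common_nbrs g_sym g_irr ore pq gpq; apply: leq_trans.
  by have := cardsC [set p; q]; rewrite cards2 pq T5; lia.
have [a [b [ua ub ab gab]]] := nonadjacent_nbrs u.
have au : a != u by rewrite eq_sym adj_neq.
have bu : b != u by rewrite eq_sym adj_neq.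
have av : a != v by apply: contraTneq ua => ->.
have bv : b != v by apply: contraTneq ub => ->.
have [|c] := @fresh [:: u; v; a; b]; first by rewrite T5.
rewrite !inE !negb_or => /and4P[cu cv ca cb].
have /andP[uc vc] := full _ _ _ uv guv cu cv.
have /andP[_ va] := full _ _ _ uv guv au av.
have /andP[_ vb] := full _ _ _ uv guv bu bv.
have /andP[ac bc] := full _ _ _ ab gab ca cb.
apply: (@del_graph_iso _ _ [:: u; a; v; b; c] u) => //.
  by rewrite /= !inE !negb_or -!andbA; repeat (apply/andP; split) => //; rewrite eq_sym.
move=> [|[|[|[|[|i]]]]] [|[|[|[|[|j]]]]] //=;
  rewrite ?andbF // => _; by rewrite ?(negPf guv) ?(negPf gab) ?ua ?ub ?uc ?vb ?vc ?ac ?bc // g_sym ?va.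
Qed.

Lemma iso_B6 x : #|T| = 6%N -> deg g x = 3%N ->
  #|T|%:R + 14 <= \sum_v 12 / (deg g v)%:R :> rat -> graph_iso g B6.
Proof.
move=> T6 dx sumg.
have cN : #|nbr g x| = 3%N by rewrite -deg_nbr.
have [a [b [xa xb ab gab]]] := nonadjacent_nbrs x.
have /set0Pn[c] : nbr g x :\ a :\ b != set0.
  rewrite -card_gt0; have := cardsD1 b (nbr g x :\ a); have := cardsD1 a (nbr g x).
  by rewrite cN; do 2 case: (_ \in _); lia.
rewrite !in_setD1 => /and3P[cb ca]; rewrite inE => xc.
have NE : nbr g x = [set a; b; c].
  apply/esym/eqP; rewrite eqEcard cN; apply/andP; split.
    by apply/subsetP => z; rewrite !inE -orbA => /or3P[] /eqP->.
  by rewrite setUC cardsU1 !inE negb_or ca cb cards2 ab.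
have cM : #|~: (x |: nbr g x)| = 2%N.
  by have := card_M g_irr x; rewrite dx T6; lia.
have /eqP/cards2P[y [z [yz ME]]] := cM.
have yM : y \in ~: (x |: nbr g x) by rewrite ME !inE eqxx.
have zM : z \in ~: (x |: nbr g x) by rewrite ME !inE eqxx orbT.
have [ax bx cx] : [/\ a != x, b != x & c != x].
  by split; rewrite eq_sym; exact: adj_neq.
have adj w u : w \in ~: (x |: nbr g x) -> g x u -> g w u.
  by move=> wM xu; apply: (adj_N_M g_sym g_irr ore dx) => //; rewrite inE.
have [ya yb yc] : [/\ g y a, g y b & g y c] by split; exact: adj.
have [za zb zc] : [/\ g z a, g z b & g z c] by split; exact: adj.
move: (yM) (zM); rewrite !in_setC !in_setU1 !negb_or ![_ \in nbr _ _]inE.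
move=> /andP[yx xy] /andP[zx xz].
have us : uniq [:: x; y; z; a; b; c].
  rewrite /= !inE !negb_or -!andbA; repeat (apply/andP; split);
    first [done | by rewrite eq_sym | exact: adj_neq].
have mem6 u : u \in [:: x; y; z; a; b; c] by apply: mem_spanning.
have gyz : g y z.
  have : (4 <= deg g y)%N by have := deg_M ore yM; rewrite dx T6.
  rewrite deg_nbr; apply: contraTT => nyz; rewrite -ltnNge ltnS.
  have : nbr g y \subset [set x in [:: a; b; c]].
    apply/subsetP => u; rewrite !inE => yu.
    have := mem6 u; rewrite !inE => /or4P[/eqP ux|/eqP uy|/eqP uz|//].
    - by rewrite ux g_sym (negPf xy) in yu.
    - by rewrite uy g_irr in yu.
    - by rewrite uz (negPf nyz) in yu.
  move=> /subset_leq_card /leq_trans; apply; rewrite cardsE; exact: card_size.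
have deg_le u (s : seq T) : uniq s -> {subset s <= nbr g u} -> (size s <= deg g u)%N.
  by move=> us' sub; rewrite -(card_uniqP us') deg_nbr subset_leq_card //; apply/subsetP.
(* If c misses both, a and b have degree at most 3, against the required sum 7. If c meets both, the
   degrees of c, a, b are at least 5, 4, 4 and the sum of 12/d(v) is at most 18.4 < 20. *)
have cab : g c a (+) g c b.
  have [ca'|ca'] := boolP (g c a); have [cb'|cb'] := boolP (g c b) => //=; last first.
    have dle w : ~~ g w a -> ~~ g w b -> ~~ g w c -> (deg g w <= 3)%N.
      move=> wa wb wc; rewrite deg_nbr.
      apply: leq_trans (card_size [:: x; y; z]); apply/subset_leq_card/subsetP => u.
      rewrite [u \in nbr _ _]inE => wu; have := mem6 u.
      rewrite -[_ :: _]/([:: x; y; z] ++ [:: a; b; c]) mem_cat inE => /orP[//|].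
      by rewrite !inE => /or3P[] /eqP uE; move: wu; rewrite uE ?(negPf wa) ?(negPf wb) ?(negPf wc).
    have ga : (deg g a <= 3)%N by apply: dle => //; rewrite ?g_irr // g_sym.
    have gb : (deg g b <= 3)%N by apply: dle => //; rewrite ?g_irr // g_sym.
    have := ore ab gab; rewrite T6; move: ga gb; clear; lia.
  exfalso.
  have sub u (s : seq T) : all (g u) s -> {subset s <= nbr g u}.
    by move=> /allP H v vs; rewrite inE; exact: H.
  have dc : (5 <= deg g c)%N.
    apply: (@deg_le c [:: x; y; z; a; b]).
      by apply: subseq_uniq us; rewrite /= !eqxx.
    by apply: sub; rewrite /= ![g c _]g_sym xc yc zc ![g _ c]g_sym ca' cb'.
  have u4 : uniq [:: x; y; z; c].
    by apply: subseq_uniq us; rewrite /= !eqxx /= (negPf ca) /= (negPf cb) /= ?eqxx.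
  have da : (4 <= deg g a)%N.
    apply: (@deg_le a [:: x; y; z; c]) => //.
    by apply: sub; rewrite /= ![g a _]g_sym xa ya za ca'.
  have db : (4 <= deg g b)%N.
    apply: (@deg_le b [:: x; y; z; c]) => //.
    by apply: sub; rewrite /= ![g b _]g_sym xb yb zb cb'.
  have hc := @inv_deg_le _ _ c 5%N dc.
  have ha := @inv_deg_le _ _ a 4%N da.
  have hb := @inv_deg_le _ _ b 4%N db.
  have := sum_M_le g_irr ore x; rewrite dx T6 -[(_ - _)%N]/2%N -[(_ - _)%N]/4%N => hM.
  move: sumg; rewrite (sum_split g_irr x) dx T6.
  have -> : \sum_(v in nbr g x) 12 / (deg g v)%:R
      = 12 / (deg g c)%:R + (12 / (deg g a)%:R + 12 / (deg g b)%:R) :> rat.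
    by rewrite NE setUC big_setU1 ?inE ?negb_or ?ca ?cb //= big_setU1 ?inE //= big_set1.
  move: hM ha hb hc.
  move: (\sum_(v in _) _) (12 / (deg g a)%:R) (12 / (deg g b)%:R) (12 / (deg g c)%:R) => A B C D.
  lra.
(* The deleted paths are y - x - z and p - q - c, where q is the one of a and b not adjacent to
   c. *)
have B6_iso p q : g x p -> g x q -> uniq [:: y; x; z; p; q; c] ->
    ~~ g p q -> g p c -> ~~ g q c -> graph_iso g B6.
  move=> xp xq us' gpq gpc gqc.
  have [yp yq zp zq] : [/\ g y p, g y q, g z p & g z q] by split; exact: adj.
  apply: (@del_graph_iso _ _ [:: y; x; z; p; q; c] x) => //.
  move=> [|[|[|[|[|[|i]]]]]] [|[|[|[|[|[|j]]]]]] //=;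
  rewrite ?andbF // => _;
  by rewrite ?(negPf xz) ?(negPf gpq) ?(negPf gqc) ?yp ?yq ?zp ?zq ?xp ?xq
    ?yc ?zc ?xc ?gpc ?gyz // g_sym (negPf xy).
have usab : uniq [:: y; x; z; a; b; c].
  by move: us; rewrite -(perm_uniq (_ : perm_eq [:: y; x; z; a; b; c] _)) // (perm_catCA [:: y] [:: x]).
have usba : uniq [:: y; x; z; b; a; c].
  rewrite (perm_uniq (_ : perm_eq _ [:: y; x; z; a; b; c])) //.
  by rewrite !perm_cons (perm_catCA [:: b] [:: a]).
have [gca|gca] := boolP (g c a).
  move: cab; rewrite gca => /= gcb; apply: (@B6_iso a b) => //; first by rewrite g_sym.
  by rewrite g_sym.
move: cab; rewrite (negPf gca) => /= gcb; apply: (@B6_iso b a) => //; rewrite g_sym //.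
Qed.

End Exceptions.

(** * Seven vertices with a 2-regular complement *)

Section TwoRegular.
Variables (T : finType) (g h : rel T).
Hypotheses (g_sym : ssrbool.symmetric g) (g_irr : ssrbool.irreflexive g).
Hypothesis hE : forall x y, h x y = (x != y) && ~~ g x y.
Hypothesis two : forall v, exists a b, a != b /\ forall y, h v y = (y == a) || (y == b).

Let h_sym : ssrbool.symmetric h.
Proof. by move=> x y; rewrite !hE eq_sym g_sym. Qed.

Let h_neq x y : h x y -> x != y.
Proof. by rewrite hE => /andP[]. Qed.

Lemma two_nbrs v a b : h v a -> h v b -> a != b -> forall y, h v y = (y == a) || (y == b).
Proof.
have [p [q [pq H]]] := two v; rewrite !H => /orP[] /eqP-> /orP[] /eqP->; rewrite ?eqxx // => _ y.
by rewrite H orbC.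
Qed.

Lemma other_nbr u v : h u v -> exists w, [/\ w != u, h v w & forall y, h v y = (y == u) || (y == w)].
Proof.
move=> huv; have hvu : h v u by rewrite h_sym.
have [p [q [pq H]]] := two v; move: (hvu); rewrite H => /orP[] /eqP uE.
  exists q; rewrite uE eq_sym pq; split => //; first by rewrite H eqxx orbT.
exists p; rewrite uE pq; split => //; first by rewrite H eqxx.
by move=> y; rewrite H orbC.
Qed.

(** Prevents a walk from returning to a vertex whose two neighbours are already known. *)
Lemma not_nbr u w v a b : (forall y, h v y = (y == a) || (y == b)) ->
  h u w -> u != a -> u != b -> w != v.
Proof.
move=> H huw ua ub; apply: contraTneq huw => ->.
by rewrite h_sym H (negPf ua) (negPf ub).
Qed.

Definition nbr_closed (c : seq T) := forall v y, v \in c -> h v y -> y \in c.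

Lemma nbr_closed_notin c v y : nbr_closed c -> h v y -> v \notin c -> y \notin c.
Proof. by move=> cc hvy; apply: contra => yc; apply: cc yc _; rewrite h_sym. Qed.

Lemma nbr_closed_ext c y p q : nbr_closed c -> uniq c -> y \notin c ->
  h y p -> h y q -> p != q -> uniq ([:: y; p; q] ++ c).
Proof.
move=> cc uc yc hyp hyq pq.
rewrite cat_uniq uc andbT /= !inE !negb_or pq (h_neq hyp) (h_neq hyq) /=.
rewrite -all_predC; apply/allP => z zc /=; rewrite !inE !negb_or.
have H w : w \notin c -> z != w by apply: contraNneq => <-.
by rewrite !H // (nbr_closed_notin cc _ yc).
Qed.

(** A vertex outside a union of cycles brings its two neighbours along. For seven vertices this
    excludes a union of cycles on 5 or 6 of them. *)
Lemma nbr_closed_size c : nbr_closed c -> uniq c -> (size c < #|T|)%N -> (size c + 3 <= #|T|)%N.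
Proof.
move=> cc uc /fresh[y yc]; have [p [q [pq H]]] := two y.
have := uniq_size_le (nbr_closed_ext cc uc yc (_ : h y p) (_ : h y q) pq).
by rewrite size_cat addnC; apply; rewrite H eqxx ?orbT.
Qed.

(** [P] and [Q] give the positions in [s] of the two neighbours of each vertex; the last hypothesis
    equates two boolean tables and is settled by computation. *)
Lemma two_regular_iso n del (s : seq T) (P Q : seq nat) x0 :
  #|T| = n -> uniq s -> size s = n ->
  (forall i, (i < n)%N -> [/\ (nth 0 P i < n)%N, (nth 0 Q i < n)%N &
     forall y, h (nth x0 s i) y = (y == nth x0 s (nth 0 P i)) || (y == nth x0 s (nth 0 Q i))]) ->
  [seq [seq listed del i j | j <- iota 0 n] | i <- iota 0 n] =
  [seq [seq (j == nth 0 P i) || (j == nth 0 Q i) | j <- iota 0 n] | i <- iota 0 n] ->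
  graph_iso g (@del_graph n del).
Proof.
move=> Tn us sn H E; apply: (@del_graph_iso _ _ g_sym g_irr n del s x0) => // i j /andP[ij jn].
have iltn := ltn_trans ij jn; have [Pn Qn Hi] := H i iltn.
have : listed del i j = (j == nth 0 P i) || (j == nth 0 Q i).
  have := congr1 (fun M => nth false (nth [::] M i) j) E.
  by rewrite !(nth_map 0) ?size_iota // !nth_iota.
have ne : nth x0 s i != nth x0 s j by rewrite nth_uniq ?sn // neq_ltn ij.
have := Hi (nth x0 s j); rewrite !nth_uniq ?sn // hE ne /= => <- ->.
by rewrite negbK.
Qed.

Lemma two_regular_triangle x y z p q r s : #|T| = 7%N ->
  uniq [:: x; y; z; p; q; r; s] ->
  h x y -> h y z -> h z x -> h p q -> h q r -> h r s -> h s p -> graph_iso g C71.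
Proof.
move=> T7 us xy yz zx pq qr rs sp.
apply: (@two_regular_iso 7 _ [:: x; y; z; p; q; r; s]
  [:: 1; 2; 0; 4; 5; 6; 3]%N [:: 2; 0; 1; 6; 3; 4; 5]%N x) => //.
have ne i j : (i < 7)%N -> (j < 7)%N -> i != j ->
    nth x [:: x; y; z; p; q; r; s] i != nth x [:: x; y; z; p; q; r; s] j.
  by move=> i7 j7; rewrite nth_uniq.
move=> [|[|[|[|[|[|[|i]]]]]]] //= _; split => //; apply: two_nbrs => //;
  by [rewrite h_sym | exact: (ne 1 2)%N | exact: (ne 2 0)%N | exact: (ne 0 1)%N
     | exact: (ne 4 6)%N | exact: (ne 5 3)%N | exact: (ne 6 4)%N | exact: (ne 3 5)%N].
Qed.

Lemma two_regular_heptagon a b c d e f i : #|T| = 7%N ->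
  uniq [:: a; b; c; d; e; f; i] ->
  h a b -> h b c -> h c d -> h d e -> h e f -> h f i -> h i a -> graph_iso g C72.
Proof.
move=> T7 us ab bc cd de ef fi ia.
apply: (@two_regular_iso 7 _ [:: a; b; c; d; e; f; i]
  [:: 1; 2; 3; 4; 5; 6; 0]%N [:: 6; 0; 1; 2; 3; 4; 5]%N a) => //.
have ne j k : (j < 7)%N -> (k < 7)%N -> j != k ->
    nth a [:: a; b; c; d; e; f; i] j != nth a [:: a; b; c; d; e; f; i] k.
  by move=> i7 j7; rewrite nth_uniq.
move=> [|[|[|[|[|[|[|k]]]]]]] //= _; split => //; apply: two_nbrs => //;
  by [rewrite h_sym | exact: (ne 1 6)%N | exact: (ne 2 0)%N | exact: (ne 3 1)%N
     | exact: (ne 4 2)%N | exact: (ne 5 3)%N | exact: (ne 6 4)%N | exact: (ne 0 5)%N].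
Qed.

(** Walk from x0 through x1, where x6 is the other neighbour of x0; the cycle closes on reaching x6.
    Lengths 3 and 4 leave a complementary cycle of length 4 or 3, lengths 5 and 6 leave too few
    vertices, length 7 is the heptagon. *)
Lemma two_regular_seven : #|T| = 7%N -> graph_iso g C71 \/ graph_iso g C72.
Proof.
move=> T7; have [|x0 _] := @fresh T [::]; first by rewrite T7.
have [x1 [x6 [x16 H0]]] := two x0.
have h01 : h x0 x1 by rewrite H0 eqxx.
have h06 : h x0 x6 by rewrite H0 eqxx orbT.
have n01 := h_neq h01; have n06 := h_neq h06.
have [x2 [n20 h12 H1]] := other_nbr h01; have n12 := h_neq h12.
have [x26|x26] := eqVneq x2 x6.
  rewrite x26 in h12 n12 H1.
  have cc : nbr_closed [:: x0; x1; x6].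
    move=> v y; rewrite !inE => /or3P[] /eqP->.
    - by rewrite H0 => /orP[] ->; rewrite ?orbT.
    - by rewrite H1 => /orP[] ->; rewrite ?orbT.
    - have -> := two_nbrs (v := x6) (a := x0) (b := x1) _ _ n01; rewrite 1?h_sym //.
      by case/orP => ->; rewrite ?orbT.
  have uc : uniq [:: x0; x1; x6] by rewrite /= !inE negb_or n01 n06 n12.
  have [|y yc] := @fresh T [:: x0; x1; x6]; first by rewrite T7.
  have [p [q [pq Hy]]] := two y.
  have yp : h y p by rewrite Hy eqxx.
  have yq : h y q by rewrite Hy eqxx orbT.
  have uypq := nbr_closed_ext cc uc yc yp yq pq.
  have pc := nbr_closed_notin cc yp yc; have qc := nbr_closed_notin cc yq yc.
  have [w [wy pw Hp]] := other_nbr yp; have wc := nbr_closed_notin cc pw pc.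
  (* A second triangle would leave a single vertex. *)
  have [wq|wq] := eqVneq w q.
    rewrite wq in pw Hp.
    have cc' : nbr_closed ([:: y; p; q] ++ [:: x0; x1; x6]).
      move=> v z; rewrite mem_cat => /orP[|vc hvz]; last by rewrite mem_cat (cc v) ?orbT.
      rewrite !inE => /or3P[] /eqP->.
      - by rewrite Hy => /orP[] ->; rewrite ?orbT.
      - by rewrite Hp => /orP[] ->; rewrite ?orbT.
      - have -> := two_nbrs (v := q) (a := y) (b := p) _ _ (h_neq yp); rewrite 1?h_sym //.
        by case/orP => ->; rewrite ?orbT.
    by have := nbr_closed_size cc' uypq; rewrite T7 => /(_ isT).
  have np := h_neq pw.
  have us : uniq (w :: [:: y; p; q] ++ [:: x0; x1; x6]).
    rewrite cons_uniq uypq andbT mem_cat negb_or wc andbT !inE !negb_or wy wq.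
    by rewrite eq_sym np.
  have [w' [w'p ww' Hw]] := other_nbr pw.
  have w'c := nbr_closed_notin cc ww' wc.
  have w'y : w' != y.
    by apply: not_nbr Hy ww' _ _; rewrite // eq_sym.
  have w'q : w' = q.
    have := @mem_spanning T _ w' us; rewrite T7 => /(_ erefl).
    rewrite in_cons mem_cat (negPf w'c) orbF !inE (negPf w'y) (negPf w'p) /=.
    by rewrite [w' == w]eq_sym (negPf (h_neq ww')) => /eqP.
  left; apply: (@two_regular_triangle x0 x1 x6 y p w q) => //; try by rewrite h_sym.
    rewrite -(perm_uniq (_ : perm_eq (w :: [:: y; p; q] ++ [:: x0; x1; x6]) _)) //.
    rewrite -[_ :: _ in X in perm_eq _ X]/([:: x0; x1; x6] ++ [:: y; p] ++ w :: [:: q]).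
    rewrite perm_sym perm_catC -cat_cons perm_cat2r perm_catC /=.
    by rewrite -[[:: w; q; y; p]]/(w :: [:: q] ++ [:: y; p]) perm_cons perm_catC.
  by rewrite -w'q.
have [x3 [n31 h23 H2]] := other_nbr h12; have n23 := h_neq h23.
have n30 : x3 != x0 by apply: not_nbr H0 h23 _ _; rewrite // eq_sym.
have [x36|x36] := eqVneq x3 x6.
  rewrite x36 in h23 H2 n23.
  pose c := [:: x0; x1; x2; x6].
  have uc : uniq c by rewrite /= !inE !negb_or n01 (eq_sym x0) n20 n06 n12 x16 n23.
  have cc : nbr_closed c.
    move=> v y; rewrite !inE => /or4P[] /eqP->.
    - by rewrite H0 => /orP[] ->; rewrite ?orbT.
    - by rewrite H1 => /orP[] ->; rewrite ?orbT.
    - by rewrite H2 => /orP[] ->; rewrite ?orbT.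
    - have -> := two_nbrs (v := x6) (a := x2) (b := x0) _ _ n20; rewrite 1?h_sym //.
      by case/orP => ->; rewrite ?orbT.
  have [|y yc] := @fresh T c; first by rewrite T7.
  have [p [q [pq Hy]]] := two y.
  have yp : h y p by rewrite Hy eqxx.
  have yq : h y q by rewrite Hy eqxx orbT.
  have us := nbr_closed_ext cc uc yc yp yq pq.
  have [w [wy pw Hp]] := other_nbr yp.
  have wc := nbr_closed_notin cc pw (nbr_closed_notin cc yp yc).
  have wq : w = q.
    have := @mem_spanning T _ w us; rewrite T7 => /(_ erefl).
    rewrite mem_cat (negPf wc) orbF !inE (negPf wy) /=.
    by rewrite [w == p]eq_sym (negPf (h_neq pw)) => /eqP.
  rewrite wq in pw.
  left; apply: (@two_regular_triangle y p q x0 x1 x2 x6) => //; by rewrite h_sym.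
have [x4 [n42 h34 H3]] := other_nbr h23; have n34 := h_neq h34.
have n40 : x4 != x0 by apply: not_nbr H0 h34 _ _.
have n41 : x4 != x1 by apply: not_nbr H1 h34 _ _; rewrite // eq_sym.
have [x46|x46] := eqVneq x4 x6.
  rewrite x46 in h34 H3 n34 n42.
  have cc : nbr_closed [:: x0; x1; x2; x3; x6].
    move=> v y; rewrite !inE => /or4P[/eqP->|/eqP->|/eqP->|/orP[]/eqP->].
    - by rewrite H0 => /orP[] ->; rewrite ?orbT.
    - by rewrite H1 => /orP[] ->; rewrite ?orbT.
    - by rewrite H2 => /orP[] ->; rewrite ?orbT.
    - by rewrite H3 => /orP[] ->; rewrite ?orbT.
    - have -> := two_nbrs (v := x6) (a := x3) (b := x0) _ _ n30; rewrite 1?h_sym //.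
      by case/orP => ->; rewrite ?orbT.
  have uc : uniq [:: x0; x1; x2; x3; x6].
    rewrite /= !inE !negb_or -!andbA; repeat (apply/andP; split);
      by [| rewrite eq_sym].
  by have := nbr_closed_size cc uc; rewrite T7 => /(_ isT).
have [x5 [n53 h45 H4]] := other_nbr h34; have n45 := h_neq h45.
have n50 : x5 != x0 by apply: not_nbr H0 h45 _ _.
have n51 : x5 != x1 by apply: not_nbr H1 h45 _ _.
have n52 : x5 != x2 by apply: not_nbr H2 h45 _ _; rewrite // eq_sym.
have [x56|x56] := eqVneq x5 x6.
  rewrite x56 in h45 H4 n45 n53.
  have cc : nbr_closed [:: x0; x1; x2; x3; x4; x6].
    move=> v y; rewrite !inE => /or4P[/eqP->|/eqP->|/eqP->|/or3P[]/eqP->].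
    - by rewrite H0 => /orP[] ->; rewrite ?orbT.
    - by rewrite H1 => /orP[] ->; rewrite ?orbT.
    - by rewrite H2 => /orP[] ->; rewrite ?orbT.
    - by rewrite H3 => /orP[] ->; rewrite ?orbT.
    - by rewrite H4 => /orP[] ->; rewrite ?orbT.
    - have -> := two_nbrs (v := x6) (a := x4) (b := x0) _ _ n40; rewrite 1?h_sym //.
      by case/orP => ->; rewrite ?orbT.
  have uc : uniq [:: x0; x1; x2; x3; x4; x6].
    rewrite /= !inE !negb_or -!andbA; repeat (apply/andP; split);
      by [| rewrite eq_sym].
  by have := nbr_closed_size cc uc; rewrite T7 => /(_ isT).
have us : uniq [:: x0; x1; x2; x3; x4; x5; x6].
  rewrite /= !inE !negb_or -!andbA; repeat (apply/andP; split);
    by [| rewrite eq_sym].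
have [w [w4 h5w H5]] := other_nbr h45.
have w6 : w = x6.
  have := @mem_spanning T _ w us; rewrite T7 => /(_ erefl).
  have /negPf w0 : w != x0 by apply: not_nbr H0 h5w _ _.
  have /negPf w1 : w != x1 by apply: not_nbr H1 h5w _ _.
  have /negPf w2 : w != x2 by apply: not_nbr H2 h5w _ _.
  have /negPf w3 : w != x3 by apply: not_nbr H3 h5w _ _; rewrite // eq_sym.
  rewrite !inE w0 w1 w2 w3 (negPf w4) /= [w == x5]eq_sym (negPf (h_neq h5w)) => /eqP //.
right; apply: (@two_regular_heptagon x0 x1 x2 x3 x4 x5 x6) => //; last by rewrite h_sym.
by rewrite -w6.
Qed.

End TwoRegular.

Lemma degree_four_seven (T : finType) (g : rel T) :
  ssrbool.symmetric g -> ssrbool.irreflexive g -> #|T| = 7%N ->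
  (forall v, deg g v = 4%N) -> graph_iso g C71 \/ graph_iso g C72.
Proof.
move=> g_sym g_irr T7 d4.
pose h x y := (x != y) && ~~ g x y.
apply: (@two_regular_seven T g h) => // v.
have /eqP/cards2P[a [b [ab H]]] : #|~: (v |: nbr g v)| = 2%N.
  by have := cardsC (v |: nbr g v); rewrite cardsU1 inE g_irr -deg_nbr d4 T7 /=; lia.
exists a, b; split => // y; have : (y \in ~: (v |: nbr g v)) = (y \in [set a; b]) by rewrite H.
by rewrite !inE negb_or eq_sym.
Qed.

(** * Conclusion *)

Section RigidityClosure.
Variables (R : realType) (T : finType) (e : rel T) (p : T -> 'I_3 -> R).
Hypothesis gp : generic p.

Definition rig_closure : rel T :=
  fun x y => (x != y) && (rig_row p x y <= rig_mx p e)%MS.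

Lemma rig_closure_sym : ssrbool.symmetric rig_closure.
Proof. by move=> x y; rewrite /rig_closure eq_sym rig_rowC. Qed.

Lemma rig_closure_irr : ssrbool.irreflexive rig_closure.
Proof. by move=> x; rewrite /rig_closure eqxx. Qed.

Lemma sub_rig_closure : ssrbool.irreflexive e -> subrel e rig_closure.
Proof.
move=> e_irr x y exy; apply/andP; split; last exact: rig_row_sub.
by apply: contraTneq exy => ->; rewrite e_irr.
Qed.

Lemma rig_closure_closed a b c y z :
  rig_closure a b -> rig_closure a c -> rig_closure b c ->
  rig_closure y a -> rig_closure y b -> rig_closure y c ->
  rig_closure z a -> rig_closure z b -> rig_closure z c -> y != z -> rig_closure y z.
Proof.
move=> /andP[ab rab] /andP[ac rac] /andP[bc rbc].
move=> /andP[ya rya] /andP[yb ryb] /andP[yc ryc] /andP[za rza] /andP[zb rzb] /andP[zc rzc] yz.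
apply/andP; split => //.
apply: (@double_cone _ _ _ _ _ _ _ (tnth [tuple a; b; c])) => //.
- exact: tnth3_inj.
- by apply: (@tnth3P _ (fun x => x != y)); rewrite eq_sym.
- by apply: (@tnth3P _ (fun x => x != z)); rewrite eq_sym.
- by case=> [[|[|[|?]]] ?] [[|[|[|?]]] ?] //= _;
    rewrite -?[tnth _ _]/a -?[tnth _ _]/b -?[tnth _ _]/c // rig_rowC.
- exact: (@tnth3P _ (fun x => rig_row p y x <= rig_mx p e)%MS).
- exact: (@tnth3P _ (fun x => rig_row p z x <= rig_mx p e)%MS).
Qed.

Definition rig_rank (W : {set T}) : nat := \rank (rig_mx p (induced_rel rig_closure W)).

Lemma induced_closure_sub W : (rig_mx p (induced_rel rig_closure W) <= rig_mx p e)%MS.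
Proof. by apply: rig_mx_subP => x y /and3P[_ _ /andP[]]. Qed.

Lemma rig_rank_increment (W : {set T}) v : v \notin W ->
  (rig_rank W)%:R + increment rig_closure (nbr rig_closure v :&: W)
    <= (rig_rank (v |: W))%:R :> rat.
Proof.
move=> vW; set S := nbr rig_closure v :&: W.
have gS u : u \in S -> rig_closure v u by rewrite !inE => /andP[].
have SW : S \subset W by exact: subsetIr.
rewrite /increment; case: ifP => [/andP[S4 /forall_inPn[a aS /forall_inPn[b bS]]] | _].
  rewrite negb_imply => /andP[ab gab].
  have /card_gt1P[c [d [cS dS cd]]] : (1 < #|S :\ a :\ b|)%N.
    have := cardsD1 b (S :\ a); have := cardsD1 a S.
    by rewrite aS in_setD1 bS eq_sym ab; move: S4; clear; lia.
  move: cS dS; rewrite !in_setD1 => /and3P[cb ca cS] /and3P[db da dS].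
  rewrite -natrD ler_nat.
  apply: (@one_extension R T 3 p _ W v a b (tnth [tuple b; c; d]) ord0) => //.
  - by apply: tnth3_inj; rewrite // eq_sym.
  - by apply: (@tnth3P _ (fun x => x != a)); rewrite // eq_sym.
  - exact: (subsetP SW).
  - by apply: (@tnth3P _ (fun x => x \in W)); exact: (subsetP SW).
  - exact: gS.
  - by apply: (@tnth3P _ (fun x => rig_closure v x)); exact: gS.
  (* The rows of g on [W] lie in the span of the rows of [e], so a row in their span would make ab
     an edge of g. *)
  - apply: contra gab => rab; rewrite /rig_closure ab.
    exact: submx_trans rab (induced_closure_sub W).
rewrite -natrD ler_nat; exact: zero_extension.
Qed.

Lemma rig_rank_deficient (x y a b c : T) : a != b -> a != c -> b != c ->
  x != y -> ~~ rig_closure x y -> (rig_rank setT + 7 <= 3 * #|T|)%N.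
Proof.
move=> ab ac bc xy nxy; have := rank_complete_le gp ab ac bc.
have : (\rank (rig_mx p e) < \rank (rig_mx p (fun _ _ => true)))%N.
  have sub : (rig_mx p e <= rig_mx p (fun _ _ => true))%MS by apply: rig_mx_sub.
  rewrite ltn_neqAle mxrankS // andbT (mxrank_leqif_sup sub).2.
  apply: contra nxy => sub'; rewrite /rig_closure xy.
  by apply: submx_trans sub'; exact: rig_row_sub.
have := mxrankS (induced_closure_sub setT); rewrite -/(rig_rank setT).
by move: (rig_rank _) (\rank _) (\rank _) => i j k; lia.
Qed.

End RigidityClosure.

Theorem theorem5p1 (R : realType) (T : finType) (e : rel T) :
  simple_graph e ->
  ~ graph_iso e W5 -> ~ graph_iso e B6 -> ~ graph_iso e C71 -> ~ graph_iso e C72 ->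
  (forall u v : T, u != v -> ~~ e u v -> (deg e u + deg e v >= #|T|.+1)%N) ->
  rigid_in R 3 e.
Proof.
move=> [e_sym e_irr] nW5 nB6 nC71 nC72 ore p gp.
pose g := rig_closure e p.
have g_sym : ssrbool.symmetric g by exact: rig_closure_sym.
have g_irr : ssrbool.irreflexive g by exact: rig_closure_irr.
have eg : subrel e g by exact: sub_rig_closure.
have [complete | ] := boolP [forall x, forall y, (x != y) ==> g x y].
  apply: inf_rigid_rigid => // x y; have [->|xy] := eqVneq x y.
    by rewrite rig_row_refl sub0mx.
  by have /forallP /(_ x) /forallP /(_ y) /implyP /(_ xy) /andP[] := complete.
rewrite negb_forall => /existsP[x]; rewrite negb_forall => /existsP[y].
rewrite negb_imply => /andP[xy gxy]; exfalso.
have g_closed := rig_closure_closed gp : forall a b c y z, g a b -> g a c -> g b c ->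
  g y a -> g y b -> g y c -> g z a -> g z b -> g z c -> y != z -> g y z.
have g_inc : exists x y, x != y /\ ~~ g x y by exists x, y.
have deg_eg v : (deg e v <= deg g v)%N.
  by rewrite !deg_nbr; apply/subset_leq_card/subsetP => w; rewrite !inE; exact: eg.
have ore_g u v : u != v -> ~~ g u v -> (deg g u + deg g v >= #|T|.+1)%N.
  move=> uv guv; apply: leq_trans (leq_add (deg_eg u) (deg_eg v)).
  by apply: ore => //; apply: contra guv; exact: eg.
have e_inc := incomplete_sub eg g_inc.
have n5 := card_ge5 e_sym e_irr ore e_inc.
have deg3 := deg_ge3 e_sym e_irr ore e_inc.
have nbr_nc := nbr_not_clique g_sym g_closed e_sym e_irr eg ore g_inc.
have [a [b [c [_ _ _ /and3P[ab ac bc]]]]] : exists a b c : T,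
    [/\ a \in [set: T], b \in [set: T], c \in [set: T] & [&& a != b, a != c & b != c]].
  by apply: three_in; rewrite cardsT; apply: leq_trans n5.
(* The inequality is proved for g and weakened to [e], since 12/d decreases in d; the case analysis
   then concerns [e] itself. *)
have deg_sum : #|T|%:R + 14 <= \sum_v 12 / (deg e v)%:R :> rat.
  have h := sum_inv_deg g_sym g_irr g_closed ore_g g_inc.
  have := h _ (@rig_rank_increment _ _ e _ gp) (rig_rank_deficient gp ab ac bc xy gxy).
  move/le_trans; apply.
  apply: ler_sum => v _; apply: inv_deg_le; rewrite deg_eg andbT.
  exact: leq_trans (deg3 v).
case: (degree_dichotomy e_sym e_irr ore e_inc nbr_nc deg3 deg_sum n5).
- move=> T5; have [u [v [uv euv]]] := e_inc.
  exact/nW5/(iso_W5 e_sym e_irr ore nbr_nc T5 uv euv).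
- move=> [T6 [u du]]; exact/nB6/(iso_B6 e_sym e_irr ore nbr_nc T6 du deg_sum).
- by move=> [T7 d4]; case: (degree_four_seven e_sym e_irr T7 d4).
Qed.
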